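(* Let $W$ be a complex reflection group with reflection representation $\mathfrak{h}$, and let $c:S\to\mathbb{C}$ be a conjugation-invariant function on the set $S$ of reflections. Then $c$ is totally aspherical if and only if the spherical subalgebra $eH_ce$ is a simple algebra.
   Context: Rational Cherednik algebra. For $s\in S$ choose $\alpha_s\in\mathfrak{h}^*$, $\alpha_s^\vee\in\mathfrak{h}$ with $s\alpha_s=\lambda_s\alpha_s$, $s\alpha_s^\vee=\lambda_s^{-1}\alpha_s^\vee$, $\lambda_s\in\mathbb{C}\setminus\{1\}$, $\langle\alpha_s,\alpha_s^\vee\rangle=2$. The algebra $H_c=H_c(W)$ is the quotient of $T(\mathfrak{h}\oplus\mathfrak{h}^* )\# W$ by the relations $[x,x']=[y,y']=0$, $[y,x]=\langle y,x\rangle-\sum_{s\in S}c(s)\langle x,\alpha_s^\vee\rangle\langle y,\alpha_s\rangle s$ for $x,x'\in\mathfrak{h}^*$, $y,y'\in\mathfrak{h}$. Let $e=|W|^{-1}\sum_{w\in W}w\in\mathbb{C}W\subset H_c$. The spherical subalgebra is $eH_ce$ (with unit $e$). ''Simple'' means having no two-sided ideals other than $0$ and the whole algebra. $\mathcal{O}_c(W)$ is the full subcategory of $H_c$-modules that are finitely generated over $S(\mathfrak{h}^* )\subset H_c$ and on which $\mathfrak{h}$ acts locally nilpotently. The parameter $c$ is totally aspherical if for every $M\in\mathcal{O}_c(W)$ the conditions (i) $M$ is torsion as an $S(\mathfrak{h}^* )$-module and (ii) $eM=0$ are equivalent. *)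

(* Defs.v *)
From HB Require Import structures.
From mathcomp Require Import all_boot all_order all_algebra all_fingroup all_character.
From mathcomp Require Import generic_quotient.
From mathcomp Require Import boolp classical_sets reals.
From mathcomp Require Import complex.

Set Implicit Arguments.
Unset Strict Implicit.
Unset Printing Implicit Defensive.
Import GroupScope GRing.Theory Num.Theory.
Local Open Scope ring_scope.

(* Associative unital K-algebras presented by generators X and relations
   rel : the quotient of the algebra terms over X by the least congruence
   that contains rel and makes the quotient a K-algebra.  The quotient may be
   the zero ring, so the instances below are pzRingType and lmodType K
   (lalgType requires 1 != 0); scaleAl and scaleAr complete the K-algebra
   axioms. *)
Inductive aterm (K X : Type) : Type :=
  | AGen of X
  | AScal of K
  | AAdd of aterm K X & aterm K X
  | AMul of aterm K X & aterm K X.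
Arguments AGen {K X}.
Arguments AScal {K X} _%_ring_scope.

HB.instance Definition _ (K X : Type) := gen_eqMixin (aterm K X).
HB.instance Definition _ (K X : Type) := gen_choiceMixin (aterm K X).

Declare Scope aterm_scope.
Delimit Scope aterm_scope with A.
Bind Scope aterm_scope with aterm.
Notation "s + t" := (AAdd s t) : aterm_scope.
Notation "s * t" := (AMul s t) : aterm_scope.

Section Presentation.
Variables (K : comNzRingType) (X : Type).
Implicit Types (a b : K) (s t : aterm K X).

Inductive acongr (rel : aterm K X -> aterm K X -> Prop) :
    aterm K X -> aterm K X -> Prop :=
  | acongr_rel s t : rel s t -> acongr rel s t
  | acongr_refl s : acongr rel s s
  | acongr_sym s t : acongr rel s t -> acongr rel t s
  | acongr_trans s t (u : aterm K X) : acongr rel s t -> acongr rel t u -> acongr rel s u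
  | acongr_add s s' t t' :
      acongr rel s s' -> acongr rel t t' -> acongr rel (s + t)%A (s' + t')%A
  | acongr_mul s s' t t' :
      acongr rel s s' -> acongr rel t t' -> acongr rel (s * t)%A (s' * t')%A
  | acongr_addA s t (u : aterm K X) : acongr rel (s + (t + u))%A (s + t + u)%A
  | acongr_addC s t : acongr rel (s + t)%A (t + s)%A
  | acongr_add0 s : acongr rel (AScal 0 + s)%A s
  | acongr_mulA s t (u : aterm K X) : acongr rel (s * (t * u))%A (s * t * u)%A
  | acongr_mul1 s : acongr rel (AScal 1 * s)%A s
  | acongr_mul0 s : acongr rel (AScal 0 * s)%A (AScal 0)
  | acongr_mulDl s t (u : aterm K X) : acongr rel ((s + t) * u)%A (s * u + t * u)%A
  | acongr_mulDr s t (u : aterm K X) : acongr rel (s * (t + u))%A (s * t + s * u)%A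
  | acongr_scalD a b : acongr rel (AScal (a + b)) (AScal a + AScal b)%A
  | acongr_scalM a b : acongr rel (AScal (a * b)) (AScal a * AScal b)%A
  | acongr_scalC a s : acongr rel (AScal a * s)%A (s * AScal a)%A.

Variable rel : aterm K X -> aterm K X -> Prop.

Definition acongrb s t : bool := `[< acongr rel s t >].

Lemma acongrb_refl : reflexive acongrb.
Proof. by move=> s; apply/asboolP; exact: acongr_refl. Qed.

Lemma acongrb_sym : symmetric acongrb.
Proof. by move=> s t; apply/asboolP/asboolP; exact: acongr_sym. Qed.

Lemma acongrb_trans : transitive acongrb.
Proof.
move=> t s u /asboolP st /asboolP tu; apply/asboolP.
exact: acongr_trans st tu.
Qed.

Canonical acongr_equiv :=
  EquivRel acongrb acongrb_refl acongrb_sym acongrb_trans.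

Definition palg : Type := {eq_quot acongr_equiv}%qT.
HB.instance Definition _ := Choice.on palg.

Definition pclass (t : aterm K X) : palg := (\pi_({eq_quot acongr_equiv}) t)%qT.
Definition prep (u : palg) : aterm K X := repr (u : {eq_quot acongr_equiv}%qT).

Lemma prepK : cancel prep pclass.
Proof. by move=> u; rewrite /pclass /prep reprK. Qed.

Lemma pclassP s t : pclass s = pclass t <-> acongr rel s t.
Proof.
split; first by move/eqmodP/asboolP.
by move=> st; apply/eqmodP/asboolP.
Qed.

Lemma prep_pclass t : acongr rel (prep (pclass t)) t.
Proof. by apply/pclassP; rewrite prepK. Qed.

Definition pgen (x : X) : palg := pclass (AGen x).
Definition pscal (a : K) : palg := pclass (AScal a).
Definition padd (u v : palg) : palg := pclass (prep u + prep v)%A.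
Definition pmul (u v : palg) : palg := pclass (prep u * prep v)%A.

Lemma paddE s t : padd (pclass s) (pclass t) = pclass (s + t)%A.
Proof. by apply/pclassP; apply: acongr_add; apply: prep_pclass. Qed.

Lemma pmulE s t : pmul (pclass s) (pclass t) = pclass (s * t)%A.
Proof. by apply/pclassP; apply: acongr_mul; apply: prep_pclass. Qed.

Lemma palg_ind (P : palg -> Prop) : (forall t, P (pclass t)) -> forall x, P x.
Proof. by move=> Pt x; rewrite -[x]prepK. Qed.

Ltac pquot := rewrite /pscal ?(paddE, pmulE); apply/pclassP.

Fact paddA : associative padd.
Proof.
elim/palg_ind=> s; elim/palg_ind=> t; elim/palg_ind=> u.
pquot; exact: acongr_addA.
Qed.

Fact paddC : commutative padd.
Proof. elim/palg_ind=> s; elim/palg_ind=> t; pquot; exact: acongr_addC. Qed.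

Fact padd0 : left_id (pscal 0) padd.
Proof. elim/palg_ind=> s; pquot; exact: acongr_add0. Qed.

Fact pmulA : associative pmul.
Proof.
elim/palg_ind=> s; elim/palg_ind=> t; elim/palg_ind=> u.
pquot; exact: acongr_mulA.
Qed.

Fact pmul1 : left_id (pscal 1) pmul.
Proof. elim/palg_ind=> s; pquot; exact: acongr_mul1. Qed.

Fact pscalC a : forall u, pmul (pscal a) u = pmul u (pscal a).
Proof. elim/palg_ind=> s; pquot; exact: acongr_scalC. Qed.

Fact pmul1r : right_id (pscal 1) pmul.
Proof. by move=> u; rewrite -pscalC pmul1. Qed.

Fact pmulDl : left_distributive pmul padd.
Proof.
elim/palg_ind=> s; elim/palg_ind=> t; elim/palg_ind=> u.
pquot; exact: acongr_mulDl.
Qed.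

Fact pmulDr : right_distributive pmul padd.
Proof.
elim/palg_ind=> s; elim/palg_ind=> t; elim/palg_ind=> u.
pquot; exact: acongr_mulDr.
Qed.

Fact pscalD a b : pscal (a + b) = padd (pscal a) (pscal b).
Proof. pquot; exact: acongr_scalD. Qed.

Fact pscalM a b : pscal (a * b) = pmul (pscal a) (pscal b).
Proof. pquot; exact: acongr_scalM. Qed.

Fact pmul0 : left_zero (pscal 0) pmul.
Proof. elim/palg_ind=> s; pquot; exact: acongr_mul0. Qed.

Definition popp (u : palg) : palg := pmul (pscal (-1)) u.

Fact paddN : left_inverse (pscal 0) popp padd.
Proof.
move=> u; rewrite /popp -[X in padd _ X]pmul1 -pmulDl -pscalD addNr.
exact: pmul0.
Qed.

HB.instance Definition _ :=
  GRing.isZmodule.Build palg paddA paddC padd0 paddN.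

HB.instance Definition _ :=
  GRing.Zmodule_isPzRing.Build palg pmulA pmul1 pmul1r pmulDl pmulDr.

Definition pscale (a : K) (u : palg) : palg := pscal a * u.

Fact pscaleA a b u : pscale a (pscale b u) = pscale (a * b) u.
Proof. by rewrite /pscale mulrA; congr (_ * _); rewrite pscalM. Qed.

Fact pscale1 : left_id 1 pscale.
Proof. exact: pmul1. Qed.

Fact pscaleDr : right_distributive pscale +%R.
Proof. by move=> a u v; exact: mulrDr. Qed.

Fact pscaleDl u : {morph pscale^~ u : a b / a + b}.
Proof. by move=> a b; rewrite /pscale pscalD; exact: mulrDl. Qed.

HB.instance Definition _ :=
  GRing.Zmodule_isLmodule.Build K palg pscaleA pscale1 pscaleDr pscaleDl.

Lemma scaleAl a (u v : palg) : a *: (u * v) = (a *: u) * v.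
Proof. exact: mulrA. Qed.

Lemma scaleAr a (u v : palg) : a *: (u * v) = u * (a *: v).
Proof.
have comm w : pscal a * w = w * pscal a by exact: pscalC.
by rewrite -[LHS]/(pscal a * (u * v)) mulrA comm -mulrA.
Qed.

Lemma pclassD s t : pclass (s + t)%A = pclass s + pclass t.
Proof. by rewrite -paddE. Qed.

Lemma pclassM s t : pclass (s * t)%A = pclass s * pclass t.
Proof. by rewrite -pmulE. Qed.

Lemma pclassZ a : pclass (AScal a) = a *: (1 : palg).
Proof. by rewrite -[RHS]/(pscal a * 1) mulr1. Qed.

Definition subalgebra (B : set palg) : Prop :=
  [/\ B 1, forall a u v, B u -> B v -> B (a *: u + v)
    & forall u v, B u -> B v -> B (u * v)].

Definition subalgebra_generated (G : set palg) : set palg :=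
  smallest subalgebra G.

End Presentation.

Section CornerRing.
Variables (A : pzRingType) (e : A).

Definition in_corner : pred A := fun a => `[< exists b, a = e * b * e >].

Definition corner (idem : e * e = e) : Type := {a : A | in_corner a}.

Fact in_corner_zmod : zmod_closed in_corner.
Proof.
split=> [|u v]; rewrite !unfold_in.
  by apply/asboolP; exists 0; rewrite mulr0 mul0r.
move=> /asboolP[a ->] /asboolP[b ->]; apply/asboolP; exists (a - b).
by rewrite mulrBr mulrBl.
Qed.

HB.instance Definition _ := GRing.isZmodClosed.Build A in_corner in_corner_zmod.

Variable idem : e * e = e.

HB.instance Definition _ := SubChoice.on (corner idem).
HB.instance Definition _ := [SubChoice_isSubZmodule of corner idem by <:].

Fact corner1_subproof : in_corner e.
Proof. by apply/asboolP; exists 1; rewrite mulr1 idem. Qed.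

Definition corner1 : corner idem := Sub e corner1_subproof.

Fact cornerM_subproof (u v : corner idem) : in_corner (val u * val v).
Proof.
case: u v => [u Hu] [v Hv] /=.
have /asboolP[a ->] := Hu; have /asboolP[b ->] := Hv.
by apply/asboolP; exists (a * e * (e * b)); rewrite !mulrA.
Qed.

Definition cornerM (u v : corner idem) : corner idem :=
  Sub (val u * val v) (cornerM_subproof u v).

Fact cornerMA : associative cornerM.
Proof. by move=> u v w; apply: val_inj; rewrite /= mulrA. Qed.

Fact cornerM1l : left_id corner1 cornerM.
Proof.
move=> [u Hu]; apply: val_inj => /=; have /asboolP[b ->] := Hu.
by rewrite !mulrA idem.
Qed.

Fact cornerM1r : right_id corner1 cornerM.
Proof.
move=> [u Hu]; apply: val_inj => /=; have /asboolP[b ->] := Hu.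
by rewrite -mulrA idem.
Qed.

Fact cornerMDl : left_distributive cornerM +%R.
Proof. by move=> u v w; apply: val_inj; rewrite /= mulrDl. Qed.

Fact cornerMDr : right_distributive cornerM +%R.
Proof. by move=> u v w; apply: val_inj; rewrite /= mulrDr. Qed.

HB.instance Definition _ := GRing.Zmodule_isPzRing.Build (corner idem)
  cornerMA cornerM1l cornerM1r cornerMDl cornerMDr.

End CornerRing.

Section SimpleRing.
Variable A : pzRingType.

Definition two_sided_ideal (I : set A) : Prop :=
  [/\ I 0, forall a b, I a -> I b -> I (a + b),
      forall a b, I b -> I (a * b) & forall a b, I a -> I (a * b)].

Definition simple_ring : Prop :=
  forall I : set A, two_sided_ideal I -> I = [set 0]%classic \/ I = setT.

End SimpleRing.

(* W acts on h = 'cV_n on the left by y |-> rho w *m y, and on h^* = 'rV_n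
   contragrediently. *)
Section ReflectionRepresentation.
Variables (K : fieldType) (n : nat) (W : finGroupType).
Variable rho : mx_representation K [set: W]%G n.

Definition pairing (y : 'cV[K]_n) (x : 'rV[K]_n) : K := (x *m y) 0 0.

Definition act (w : W) (y : 'cV[K]_n) : 'cV[K]_n := rho w *m y.

Definition dual_act (w : W) (x : 'rV[K]_n) : 'rV[K]_n := x *m rho w^-1%g.

Definition reflections : {set W} := [set s | \rank (rho s - 1%:M) == 1%N].

Definition is_complex_reflection_group : Prop :=
  mx_faithful rho /\ <<reflections>>%g = [set: W].

Definition root_choice (alpha : W -> 'rV[K]_n) (alphav : W -> 'cV[K]_n)
    (lambda : W -> K) : Prop :=
  forall s, s \in reflections ->
  [/\ dual_act s (alpha s) = lambda s *: alpha s,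
      act s (alphav s) = (lambda s)^-1 *: alphav s,
      lambda s != 1
    & pairing (alphav s) (alpha s) = 2%:R].

Definition conj_invariant (c : W -> K) : Prop :=
  forall s w, s \in reflections -> c (s ^ w)%g = c s.

End ReflectionRepresentation.

Section Cherednik.
Variables (K : numFieldType) (n : nat) (W : finGroupType).
Variable rho : mx_representation K [set: W]%G n.

Inductive cherednik_gen : Type :=
  | GX of 'rV[K]_n
  | GY of 'cV[K]_n
  | GW of W.

Local Notation term := (aterm K cherednik_gen).
Local Notation X x := (AGen (GX x) : term).
Local Notation Y y := (AGen (GY y) : term).
Local Notation T w := (AGen (GW w) : term).

(* Defining relations of the smash product T(h + h^* ) # W : linearity of
   h^* + h -> T(h + h^* ), multiplication in W, and w v = w(v) w. *)
Inductive smash_rel : term -> term -> Prop :=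
  | smash_x a x x' :
      smash_rel (X (a *: x + x')) (AScal a * X x + X x')%A
  | smash_y a y y' :
      smash_rel (Y (a *: y + y')) (AScal a * Y y + Y y')%A
  | smash_1 : smash_rel (T 1%g) (AScal 1)
  | smash_M w w' : smash_rel (T (w * w')%g) (T w * T w')%A
  | smash_Wx w x : smash_rel (T w * X x)%A (X (dual_act rho w x) * T w)%A
  | smash_Wy w y : smash_rel (T w * Y y)%A (Y (act rho w y) * T w)%A.

Definition acomm (s t : term) : term := (s * t + AScal (-1) * (t * s))%A.

Definition asum (s : seq term) : term := foldr (@AAdd _ _) (AScal 0) s.

Variables (alpha : W -> 'rV[K]_n) (alphav : W -> 'cV[K]_n) (c : W -> K).

Inductive commutator_rel : term -> term -> Prop :=
  | comm_xx x x' : commutator_rel (acomm (X x) (X x')) (AScal 0)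
  | comm_yy y y' : commutator_rel (acomm (Y y) (Y y')) (AScal 0)
  | comm_yx y x : commutator_rel (acomm (Y y) (X x))
      (AScal (pairing y x) +
       AScal (-1) * asum
         [seq AScal (c s * pairing (alphav s) x * pairing y (alpha s)) * T s
         | s <- enum (reflections rho)])%A.

Definition cherednik_rel (s t : term) : Prop :=
  smash_rel s t \/ commutator_rel s t.

Definition cherednik : Type := palg cherednik_rel.
HB.instance Definition _ := GRing.PzRing.on cherednik.
HB.instance Definition _ := GRing.Lmodule.on cherednik.

Definition xH (x : 'rV[K]_n) : cherednik := pgen cherednik_rel (GX x).
Definition yH (y : 'cV[K]_n) : cherednik := pgen cherednik_rel (GY y).
Definition wH (w : W) : cherednik := pgen cherednik_rel (GW w).

Lemma wHM w w' : wH (w * w')%g = wH w * wH w'.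
Proof.
rewrite /wH /pgen -[RHS]pclassM; apply/pclassP/acongr_rel; left.
exact: smash_M.
Qed.

Lemma pclass_asum s :
  pclass cherednik_rel (asum s) = \sum_(t <- s) pclass cherednik_rel t.
Proof.
elim: s => [|t s IHs]; first by rewrite big_nil [LHS]pclassZ scale0r.
by rewrite big_cons -IHs -pclassD.
Qed.

Lemma yHxH y x :
  yH y * xH x - xH x * yH y =
  pairing y x *: (1 : cherednik) -
  \sum_(s in reflections rho)
     (c s * pairing (alphav s) x * pairing y (alpha s)) *: wH s.
Proof.
have N1 (u : cherednik) : pclass cherednik_rel (AScal (-1)) * u = - u.
  by rewrite pclassZ -scaleAl mul1r scaleN1r.
have /pclassP := @acongr_rel _ _ cherednik_rel _ _ (or_intror (comm_yx y x)).
rewrite /acomm !(pclassD, pclassM) pclass_asum !N1 => ->.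
rewrite big_map big_enum pclassZ; congr (_ - _); apply: eq_bigr => s _.
by rewrite pclassM pclassZ -scaleAl mul1r.
Qed.

Definition eH : cherednik := (#|W|%:R : K)^-1 *: \sum_(w : W) wH w.

Lemma eH_idem : eH * eH = eH.
Proof.
have wHe w : wH w * eH = eH.
  rewrite /eH -scaleAr mulr_sumr; congr (_ *: _).
  rewrite [RHS](reindex_inj (mulgI w)) /=.
  by apply: eq_bigr => w' _; rewrite wHM.
have W0 : (#|W|%:R : K) != 0 by rewrite pnatr_eq0 -lt0n -cardsT cardG_gt0.
rewrite {1}/eH -scaleAl mulr_suml (eq_bigr (fun=> eH)) => [|w _]; last exact: wHe.
by rewrite sumr_const -[eH *+ _]scaler_nat scalerA mulVf // scale1r.
Qed.

Definition spherical : Type := corner eH_idem.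
HB.instance Definition _ := GRing.PzRing.on spherical.

(* S(h^* ) as a subalgebra of H_c, i.e. the one generated by h^*. *)
Definition Sdual : set cherednik := subalgebra_generated (range xH).

Definition fin_gen_Sdual (M : lmodType cherednik) : Prop :=
  exists (k : nat) (g : 'I_k -> M), forall m : M,
  exists2 a : 'I_k -> cherednik,
    forall i, Sdual (a i) & m = \sum_(i < k) a i *: g i.

Definition h_locally_nilpotent (M : lmodType cherednik) : Prop :=
  forall (y : 'cV[K]_n) (m : M), exists k : nat, yH y ^+ k *: m = 0.

Definition category_O (M : lmodType cherednik) : Prop :=
  fin_gen_Sdual M /\ h_locally_nilpotent M.

Definition torsion_Sdual (M : lmodType cherednik) : Prop :=
  forall m : M, exists a : cherednik, [/\ Sdual a, a != 0 & a *: m = 0].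

Definition totally_aspherical : Prop :=
  forall M : lmodType cherednik, category_O M ->
  (torsion_Sdual M <-> forall m : M, eH *: m = 0).

End Cherednik.

(* Main.v *)
From HB Require Import structures.
From mathcomp Require Import all_boot all_order all_algebra all_fingroup all_character.
From mathcomp Require Import boolp classical_sets reals complex.
From mathcomp Require Import ring ssrcomplements mpoly.
From mathcomp Require Import generic_quotient.
Require Import Defs.

Set Implicit Arguments.
Unset Strict Implicit.
Unset Printing Implicit Defensive.
Import GroupScope GRing.Theory Num.Theory.
Local Open Scope ring_scope.

(** Write [H] for the Cherednik algebra, [S] for [S(h^* )], [I] for a two-sided ideal of
    [H] and [M] for a module of category O.

    One implication between the two conditions on [M] always holds: [S] meets [HeH] in a
    nonzero element ([sep_ideal]), which kills [M] as soon as [eM = 0]. Suppose [eHe]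
    simple and [M] torsion. As [M] is finitely generated over the domain [S], it is killed
    by a nonzero [f] in [S], hence by the nonzero invariant [p], the product of the
    conjugates of [f]. Then [pe] is a nonzero element of the ideal of the elements of [eHe]
    that kill [M]; by simplicity [e] lies in it too, that is, [eM = 0].

    Conversely let [c] be totally aspherical, [J] a nonzero ideal of [eHe], and [I] the
    largest ideal of [H] with [eIe] contained in [J]; [e] has to be shown to lie in [I].
    Commutators with invariants of [S] lower the order in [h] of the elements of [He], and
    the invariants separate the leading terms, so that [I], which contains [J], contains
    some [fe] with [f] nonzero in [S] ([ideal_psi_eq0]), and then a nonzero element of [S].
    Hence [M = H/(I + Hh)], which belongs to category O, is torsion, and asphericity gives
    [eM = 0]: [eH] is contained in [I + eHh].

    The right action of [h] is therefore surjective on [E = eH/eI]. Now [E] is finitely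
    generated under the left action of the invariants of [S] and the right action of
    [S(h)], and Nakayama's lemma provides [u = 1 + (terms of positive degree in h)] that
    annihilates [E] ([eH_nakayama]). The Euler element [eu] satisfies [[y, eu] = y] for [y]
    in [h], so that right multiplication by [eu] makes the annihilator of [E] homogeneous in
    [h]: it contains the component [1] of [u], that is, [E = 0] ([ideal_eH]).

    All this uses little of the PBW theorem: that [S W S(h)] spans [H] ([pbw_all]), and that
    [f |-> fe] is injective on [S] ([XHeH_eq0]). The second point follows from the action of
    [H] on [S] by Dunkl operators, which is constructed here; each of its relations is
    checked by comparing commutators with linear forms and values at constants. *)

(** * Polynomials acting by commuting operators *)

Lemma mnm_succ n (m : 'X_{1..n}) : m != 0%MM -> exists i m', m = (U_(i) + m')%MM.
Proof.
move=> m0; have /existsP[i mi] : [exists i, m i != 0%N].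
  apply: contraNT m0 => /existsPn m0; apply/eqP/mnmP => i.
  by rewrite mnm0E; apply/eqP; rewrite -[_ == _]negbK.
by exists i, (m - U_(i))%MM; rewrite addmC submK ?lep1mP.
Qed.

Lemma mnm_ind n (P : 'X_{1..n} -> Prop) :
  P 0%MM -> (forall i m, P m -> P (U_(i) + m)%MM) -> forall m, P m.
Proof.
move=> P0 PU m; have [d] := ubnP (mdeg m); elim: d m => // d IHd m.
have [-> //|/mnm_succ[i [m' ->]]] := eqVneq m 0%MM.
by rewrite mdegD mdeg1 ltnS => md; apply/PU/IHd.
Qed.

Lemma mpoly_mul_ind n (S : nzRingType) (P : {mpoly S[n]} -> Prop) :
    (forall c, P c%:MP) -> (forall p q, P p -> P q -> P (p + q)) ->
    (forall i p, P p -> P ('X_i * p)) ->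
  forall p, P p.
Proof.
move=> PC PD PM; elim/mpolyind => [|c m p _ _ Pp]; first by rewrite -mpolyC0.
apply: PD => // {p Pp}; elim/mnm_ind: m => [|i m IHm].
  by rewrite mpolyX0 -mul_mpolyC mulr1.
rewrite mpolyXD -mul_mpolyC mulrA (commr_mpolyX _ c%:MP) -mulrA mul_mpolyC.
exact: PM.
Qed.

Section OperatorAction.
Variables (S : comNzRingType) (n : nat) (G : zmodType).
Variables (sigma : S -> G -> G) (t : 'I_n -> G -> G).

(** [sigma] is a ring action of the coefficients and [t i] is the operator substituted for
    the variable ['X_i]. This serves three times: with left multiplications it embeds
    [S(h^* )] and [S(h)] in the Cherednik algebra, and with left multiplications for
    [sigma] and right multiplications for [t] it makes [S(h^* ) (x) S(h)] act on it. *)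
Definition mnmact (m : 'X_{1..n}) (z : G) : G :=
  foldr (fun i z => iter (m i) (t i) z) z (enum 'I_n).

Definition opact (u : {mpoly S[n]}) (z : G) : G :=
  \sum_(m <- msupp u) sigma u@_m (mnmact m z).

Hypothesis sigmaDl : forall a b z, sigma (a + b) z = sigma a z + sigma b z.
Hypothesis sigmaDr : forall a, {morph sigma a : z w / z + w}.
Hypothesis sigma1 : forall z, sigma 1 z = z.
Hypothesis sigmaM : forall a b z, sigma (a * b) z = sigma a (sigma b z).
Hypothesis tD : forall i, {morph t i : z w / z + w}.
Hypothesis tC : forall i j z, t i (t j z) = t j (t i z).
Hypothesis tsigma : forall i a z, t i (sigma a z) = sigma a (t i z).

Let sigma0l z : sigma 0 z = 0.
Proof. by apply: (@addrI _ (sigma 0 z)); rewrite -sigmaDl !addr0. Qed.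

Let sigma0r a : sigma a 0 = 0.
Proof. by apply: (@addrI _ (sigma a 0)); rewrite -sigmaDr !addr0. Qed.

Let t0 i : t i 0 = 0.
Proof. by apply: (@addrI _ (t i 0)); rewrite -tD !addr0. Qed.

Lemma mnmactD m : {morph mnmact m : z w / z + w}.
Proof.
rewrite /mnmact; elim: (enum _) => //= i s IHs z w.
by rewrite IHs; elim: (m i) => //= k ->; rewrite tD.
Qed.

Lemma mnmact0 z : mnmact 0%MM z = z.
Proof. by rewrite /mnmact; elim: (enum _) => //= i s ->; rewrite mnm0E. Qed.

Lemma mnmactU i m z : mnmact (U_(i) + m)%MM z = t i (mnmact m z).
Proof.
have titer j k w : t i (iter k (t j) w) = iter k (t j) (t i w).
  by elim: k => //= k <-; rewrite tC.
rewrite /mnmact.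
have sum_notin s : i \notin s ->
    foldr (fun j => iter ((U_(i) + m)%MM j) (t j)) z s = foldr (fun j => iter (m j) (t j)) z s.
  elim: s => //= j s IHs; rewrite inE negb_or => /andP[ij /IHs->].
  by rewrite mnmDE mnm1E (negPf ij).
have: uniq (enum 'I_n) by exact: enum_uniq.
have: i \in enum 'I_n by rewrite mem_enum.
elim: (enum _) => //= j s IHs; rewrite inE => /predU1P[<-|is_] /andP[js us].
  by rewrite sum_notin // mnmDE mnm1E eqxx add1n.
rewrite IHs // titer mnmDE mnm1E.
by have -> : (i == j) = false by apply: contraNF js => /eqP<-.
Qed.

Lemma opactE k u z : (msize u <= k)%N ->
  opact u z = \sum_(m : 'X_{1..n < k}) sigma u@_m (mnmact m z).
Proof.
pose I : subFinType _ := 'X_{1..n < k}.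
move=> le_uk; rewrite /opact (big_mksub I) /=; first last.
- by move=> x /msize_mdeg_lt/leq_trans/(_ le_uk).
- exact: msupp_uniq.
by rewrite big_rmcond //= => j /memN_msupp_eq0 ->.
Qed.

Lemma opactDl u v z : opact (u + v) z = opact u z + opact v z.
Proof.
pose k := maxn (msize (u + v)) (maxn (msize u) (msize v)).
have [ku kv kuv] : [/\ msize u <= k, msize v <= k & msize (u + v) <= k]%N.
  by rewrite /k !leq_max !leqnn !orbT.
rewrite !(@opactE k) // -big_split; apply: eq_bigr => m _.
by rewrite mcoeffD sigmaDl.
Qed.

Lemma opactDr u : {morph opact u : z w / z + w}.
Proof.
move=> z w; rewrite /opact -big_split; apply: eq_bigr => m _.
by rewrite mnmactD sigmaDr.
Qed.

Lemma opact0l z : opact 0 z = 0.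
Proof. by apply: (@addrI _ (opact 0 z)); rewrite -opactDl !addr0. Qed.

Lemma opactZX c m z : opact (c *: 'X_[m]) z = sigma c (mnmact m z).
Proof.
have [->|c0] := eqVneq c 0; first by rewrite scale0r opact0l sigma0l.
by rewrite /opact msuppMCX // big_seq1 mcoeffZ mcoeffX eqxx mulr1.
Qed.

Lemma opactC c z : opact c%:MP z = sigma c z.
Proof. by rewrite -[c%:MP]mulr1 mul_mpolyC -mpolyX0 opactZX mnmact0. Qed.

Lemma opact1 z : opact 1 z = z.
Proof. by rewrite -mpolyC1 opactC sigma1. Qed.

Let opactCM c v z : opact (c%:MP * v) z = sigma c (opact v z).
Proof.
elim/mpolyind: v => [|b m v _ _ IHv]; first by rewrite mulr0 !opact0l sigma0r.
rewrite mulrDr !opactDl sigmaDr IHv; congr (_ + _).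
by rewrite mul_mpolyC scalerA !opactZX sigmaM.
Qed.

Lemma opactXM i v z : opact ('X_i * v) z = t i (opact v z).
Proof.
elim/mpolyind: v => [|b m v _ _ IHv]; first by rewrite mulr0 !opact0l t0.
rewrite mulrDr !opactDl tD IHv; congr (_ + _).
by rewrite -scalerAr -mpolyXD !opactZX mnmactU tsigma.
Qed.

Lemma opactX i z : opact 'X_i z = t i z.
Proof. by rewrite -['X_i]mulr1 opactXM opact1. Qed.

Lemma opactM u v z : opact (u * v) z = opact u (opact v z).
Proof.
elim/mpoly_mul_ind: u => [c|p q IHp IHq|i p IHp].
- by rewrite opactCM opactC.
- by rewrite mulrDl !opactDl IHp IHq.
by rewrite -mulrA !opactXM IHp.
Qed.

End OperatorAction.

Section CommutingEvaluation.
Variables (K : comNzRingType) (n : nat) (A : pzRingType).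
Variables (iota : K -> A) (h : 'I_n -> A).
Hypothesis iotaD : {morph iota : a b / a + b}.
Hypothesis iotaM : {morph iota : a b / a * b}.
Hypothesis iota1 : iota 1 = 1.
Hypothesis iotaC : forall a z, iota a * z = z * iota a.
Hypothesis hC : forall i j, h i * h j = h j * h i.

Definition ceval (f : {mpoly K[n]}) : A :=
  opact (fun a z => iota a * z) (fun i z => h i * z) f 1.

Let sD a b z : iota (a + b) * z = iota a * z + iota b * z.
Proof. by rewrite iotaD mulrDl. Qed.
Let sDr a z w : iota a * (z + w) = iota a * z + iota a * w.
Proof. exact: mulrDr. Qed.
Let s1 z : iota 1 * z = z. Proof. by rewrite iota1 mul1r. Qed.
Let sM a b z : iota (a * b) * z = iota a * (iota b * z).
Proof. by rewrite iotaM mulrA. Qed.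
Let hD i z w : h i * (z + w) = h i * z + h i * w. Proof. exact: mulrDr. Qed.
Let hhC i j z : h i * (h j * z) = h j * (h i * z).
Proof. by rewrite !mulrA hC. Qed.
Let hs i a z : h i * (iota a * z) = iota a * (h i * z).
Proof. by rewrite !mulrA iotaC. Qed.

Lemma cevalD : {morph ceval : f g / f + g}.
Proof. by move=> f g; rewrite /ceval opactDl. Qed.

Lemma cevalC a : ceval a%:MP = iota a.
Proof. by rewrite /ceval opactC // mulr1. Qed.

Lemma cevalX i : ceval 'X_i = h i.
Proof. by rewrite /ceval opactX // mulr1. Qed.

Lemma cevalM : {morph ceval : f g / f * g}.
Proof.
move=> f g; rewrite [in LHS]/ceval opactM // -/(ceval g).
elim/mpoly_mul_ind: f => [c|p q IHp IHq|i p IHp].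
- by rewrite opactC // cevalC.
- by rewrite opactDl // IHp IHq cevalD mulrDl.
by rewrite opactXM // IHp mulrA /ceval [in RHS]opactXM.
Qed.

End CommutingEvaluation.

(** * Representations of a presented algebra *)

Section PresentedRepresentation.
Variables (K : comNzRingType) (X : Type) (rel : aterm K X -> aterm K X -> Prop).
Variables (V : lmodType K) (phi : X -> V -> V).

Fixpoint term_act (t : aterm K X) (v : V) : V :=
  match t with
  | AGen x => phi x v
  | AScal a => a *: v
  | AAdd t1 t2 => term_act t1 v + term_act t2 v
  | AMul t1 t2 => term_act t1 (term_act t2 v)
  end.

Hypothesis phi_lin : forall x, linear (phi x).

(** The scalars of a presented algebra are central, so linearity of the operators is part
    of what a representation has to satisfy. *)
Lemma term_act_lin t : linear (term_act t).
Proof.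
elim: t => [x|b|t1 IH1 t2 IH2|t1 IH1 t2 IH2] a u v /=.
- exact: phi_lin.
- by rewrite scalerDr !scalerA mulrC.
- by rewrite IH1 IH2 scalerDr addrACA.
by rewrite IH2 IH1.
Qed.

Hypothesis phi_rel : forall s t, rel s t -> term_act s =1 term_act t.

Lemma term_act_congr s t : acongr rel s t -> term_act s =1 term_act t.
Proof.
have actD r : {morph term_act r : u v / u + v}.
  by move=> u v; have := term_act_lin r 1 u v; rewrite !scale1r.
have act0 r : term_act r 0 = 0 by apply: (@addrI _ (term_act r 0)); rewrite -actD !addr0.
have actZ r a v : term_act r (a *: v) = a *: term_act r v.
  by have := term_act_lin r a v 0; rewrite !addr0 act0 addr0.
elim=> {s t} //=.
- by move=> s t _ IH v; rewrite IH.
- by move=> s t u _ IH1 _ IH2 v; rewrite IH1 IH2.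
- by move=> s s' t t' _ IH1 _ IH2 v; rewrite IH1 IH2.
- by move=> s s' t t' _ IH1 _ IH2 v; rewrite IH2 IH1.
- by move=> s t u v; rewrite addrA.
- by move=> s t v; rewrite addrC.
- by move=> s v; rewrite scale0r add0r.
- by move=> s v; rewrite scale1r.
- by move=> s v; rewrite !scale0r.
- by move=> s t u v; rewrite actD.
- by move=> a b v; rewrite scalerDl.
- by move=> a b v; rewrite scalerA.
- by move=> a s v; rewrite actZ.
Qed.

Definition palg_act (u : palg rel) (v : V) : V := term_act (prep u) v.

Lemma palg_act_class t : palg_act (pclass rel t) =1 term_act t.
Proof. by apply: term_act_congr; exact: prep_pclass. Qed.

Lemma palg_actDl u u' v : palg_act (u + u') v = palg_act u v + palg_act u' v.
Proof.
elim/palg_ind: u => s; elim/palg_ind: u' => t.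
by rewrite -pclassD !palg_act_class.
Qed.

Lemma palg_actM u u' v : palg_act (u * u') v = palg_act u (palg_act u' v).
Proof.
elim/palg_ind: u => s; elim/palg_ind: u' => t.
by rewrite -pclassM !palg_act_class.
Qed.

Lemma palg_act_gen x : palg_act (pgen rel x) =1 phi x.
Proof. exact: palg_act_class. Qed.

Lemma palg_act_scal a v : palg_act (pscal rel a) v = a *: v.
Proof. exact: palg_act_class. Qed.

Lemma palg_actZl a u v : palg_act (a *: u) v = a *: palg_act u v.
Proof. by rewrite -[a *: u]/(pscal rel a * u) palg_actM palg_act_scal. Qed.

End PresentedRepresentation.

(** * Linear substitutions and directional derivatives *)

Lemma mderivXU n (R : nzRingType) (i j : 'I_n) :
  ('X_j : {mpoly R[n]})^`M(i) = ((i == j)%:R)%:MP.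
Proof.
rewrite mderivX mnm1E eq_sym; have [->|_] := eqVneq i j; last by rewrite scale0r mpolyC0.
rewrite scale1r mpolyC1 -mpolyX0; congr 'X_[_].
by apply/mnmP => k; rewrite mnmBE subnn mnm0E.
Qed.

Section LinearForms.
Variables (K : numFieldType) (n : nat).
Implicit Types (x : 'rV[K]_n) (y : 'cV[K]_n) (f : {mpoly K[n]}).

Definition lform x : {mpoly K[n]} := \sum_i x 0 i *: 'X_i.

Lemma lform_is_linear : linear lform.
Proof.
move=> a x x'; rewrite /lform scaler_sumr -big_split; apply: eq_bigr => i _.
by rewrite !mxE scalerDl scalerA.
Qed.
HB.instance Definition _ :=
  GRing.isLinear.Build K 'rV[K]_n {mpoly K[n]} _ lform lform_is_linear.

Lemma lformD : {morph lform : x x' / x + x'}. Proof. exact: raddfD. Qed.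
Lemma lformB : {morph lform : x x' / x - x'}. Proof. exact: raddfB. Qed.
Lemma lformZ a x : lform (a *: x) = a *: lform x. Proof. exact: linearZ. Qed.

Lemma lform_delta i : lform (delta_mx 0 i) = 'X_i.
Proof.
rewrite /lform (bigD1 i) //= !mxE !eqxx scale1r big1 ?addr0 // => j ji.
by rewrite !mxE (negPf ji) andbF scale0r.
Qed.

Lemma lform_eq0 x : (lform x == 0) = (x == 0).
Proof.
apply/eqP/eqP => [x0|->]; last exact: raddf0.
apply/rowP => j; rewrite mxE; have := congr1 (mcoeff U_(j)%MM) x0.
rewrite /lform raddf_sum (bigD1 j) //= mcoeffZ mcoeffXU eqxx mulr1 mcoeff0.
rewrite big1 ?addr0 // => i ij; by rewrite mcoeffZ mcoeffXU (negPf ij) mulr0.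
Qed.

Lemma lform_ind (P : {mpoly K[n]} -> Prop) :
    (forall c, P c%:MP) -> (forall p q, P p -> P q -> P (p + q)) ->
    (forall x p, P p -> P (lform x * p)) ->
  forall p, P p.
Proof.
move=> PC PD PM; apply: mpoly_mul_ind => // i p Pp.
by rewrite -lform_delta; exact: PM.
Qed.

Fact lsubst_key : unit. Proof. by []. Qed.
Definition lsubst (A : 'M[K]_n) : {mpoly K[n]} -> {mpoly K[n]} :=
  locked_with lsubst_key (comp_mpoly [tuple lform (row i A) | i < n]).

Lemma lsubstE A f : lsubst A f = f \mPo [tuple lform (row i A) | i < n].
Proof. by rewrite /lsubst unlock. Qed.

Fact lsubst_is_linear A : linear (lsubst A).
Proof. by move=> a f g; rewrite !lsubstE linearP. Qed.
HB.instance Definition _ A := GRing.isLinear.Build K {mpoly K[n]} {mpoly K[n]}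
  _ (lsubst A) (lsubst_is_linear A).

Fact lsubst_is_monoid_morphism A : monoid_morphism (lsubst A).
Proof. by split=> [|f g]; rewrite !lsubstE ?rmorph1 ?rmorphM. Qed.
HB.instance Definition _ A := GRing.isMonoidMorphism.Build {mpoly K[n]} {mpoly K[n]}
  (lsubst A) (lsubst_is_monoid_morphism A).

Lemma lsubstC A c : lsubst A c%:MP = c%:MP.
Proof. by rewrite lsubstE comp_mpolyC. Qed.

Lemma lsubst_lform A x : lsubst A (lform x) = lform (x *m A).
Proof.
rewrite {1}/lform linear_sum /= [in RHS](row_sum_delta x) mulmx_suml linear_sum.
apply: eq_bigr => i _; rewrite linearZ -scalemxAl linearZ /=; congr (_ *: _).
by rewrite -rowE lsubstE comp_mpolyXU -tnth_nth tnth_mktuple.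
Qed.

Lemma lsubstM A B f : lsubst A (lsubst B f) = lsubst (B *m A) f.
Proof.
elim/lform_ind: f => [c|p q IHp IHq|x p IHp]; first by rewrite !lsubstC.
  by rewrite !raddfD /= IHp IHq.
by rewrite !rmorphM /= IHp !lsubst_lform mulmxA.
Qed.

Lemma lsubst1 f : lsubst 1%:M f = f.
Proof.
elim/lform_ind: f => [c|p q IHp IHq|x p IHp]; first by rewrite lsubstC.
  by rewrite raddfD /= IHp IHq.
by rewrite rmorphM /= IHp lsubst_lform mulmx1.
Qed.

Definition dirder y f : {mpoly K[n]} := \sum_i y i 0 *: f^`M(i).

Lemma dirder_is_linear y : linear (dirder y).
Proof.
move=> a f g; rewrite /dirder scaler_sumr -big_split; apply: eq_bigr => i _.
by rewrite linearP scalerDr !scalerA mulrC.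
Qed.
HB.instance Definition _ y :=
  GRing.isLinear.Build K {mpoly K[n]} {mpoly K[n]} _ (dirder y) (dirder_is_linear y).

Lemma dirderC y c : dirder y c%:MP = 0.
Proof. by rewrite /dirder big1 // => i _; rewrite mderivC scaler0. Qed.

Lemma dirderM y f g : dirder y (f * g) = dirder y f * g + f * dirder y g.
Proof.
rewrite /dirder mulr_suml mulr_sumr -big_split; apply: eq_bigr => i _.
by rewrite mderivM scalerDr scalerAl scalerAr.
Qed.

Lemma dirder_lform y x : dirder y (lform x) = (pairing y x)%:MP.
Proof.
rewrite /lform linear_sum /pairing mxE raddf_sum; apply: eq_bigr => j _ /=.
rewrite linearZ /= mpolyCM mul_mpolyC; congr (_ *: _).
rewrite /dirder (bigD1 j) //= mderivXU eqxx big1 ?addr0 => [|i ij].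
  by rewrite -mul_mpolyC mulr1.
by rewrite mderivXU (negPf ij) mpolyC0 scaler0.
Qed.

Lemma dirderDl y y' f : dirder (y + y') f = dirder y f + dirder y' f.
Proof.
by rewrite /dirder -big_split; apply: eq_bigr => i _; rewrite mxE scalerDl.
Qed.

Lemma dirderZl a y f : dirder (a *: y) f = a *: dirder y f.
Proof.
by rewrite /dirder scaler_sumr; apply: eq_bigr => i _; rewrite mxE scalerA.
Qed.

End LinearForms.

(** * Reflections *)

Section Reflections.
Variables (K : numFieldType) (n : nat) (W : finGroupType).
Variable rho : mx_representation K [set: W]%G n.
Implicit Types (w : W) (x : 'rV[K]_n) (y : 'cV[K]_n) (f : {mpoly K[n]}).

Lemma rhoM w w' : rho (w * w')%g = rho w *m rho w'.
Proof. by rewrite repr_mxM ?inE. Qed.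

Lemma rho_mulV w : rho w *m rho w^-1%g = 1%:M.
Proof. by rewrite -rhoM mulgV repr_mx1. Qed.

Lemma rho_mulVr w : rho w^-1%g *m rho w = 1%:M.
Proof. by rewrite -rhoM mulVg repr_mx1. Qed.

Lemma dual_actM w w' x : dual_act rho (w * w')%g x = dual_act rho w (dual_act rho w' x).
Proof. by rewrite /dual_act invMg rhoM mulmxA. Qed.

Lemma dual_act1 x : dual_act rho 1%g x = x.
Proof. by rewrite /dual_act invg1 repr_mx1 mulmx1. Qed.

Lemma actM w w' y : act rho (w * w')%g y = act rho w (act rho w' y).
Proof. by rewrite /act rhoM mulmxA. Qed.

Lemma act1 y : act rho 1%g y = y.
Proof. by rewrite /act repr_mx1 mul1mx. Qed.

Lemma pairing_act w y x : pairing (act rho w y) (dual_act rho w x) = pairing y x.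
Proof. by rewrite /pairing /act /dual_act mulmxA -(mulmxA x) rho_mulVr mulmx1. Qed.

Lemma pairingDl a y y' x : pairing (a *: y + y') x = a * pairing y x + pairing y' x.
Proof. by rewrite /pairing mulmxDr -scalemxAr !mxE. Qed.

(** The algebra automorphism that extends [dual_act w]; linear forms are rows, on which the
    matrices act on the right, whence the inverse. *)
Definition wact w : {mpoly K[n]} -> {mpoly K[n]} := lsubst (rho w^-1%g).
HB.instance Definition _ w := GRing.RMorphism.copy (wact w) (lsubst _).
HB.instance Definition _ w := GRing.Linear.copy (wact w) (lsubst _).

Lemma wactD w : {morph wact w : f g / f + g}. Proof. exact: raddfD. Qed.
Lemma wactMr w : {morph wact w : f g / f * g}. Proof. exact: rmorphM. Qed.

Lemma wact_lform w x : wact w (lform x) = lform (dual_act rho w x).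
Proof. exact: lsubst_lform. Qed.

Lemma wactM w w' f : wact (w * w')%g f = wact w (wact w' f).
Proof. by rewrite /wact lsubstM -rhoM invMg. Qed.

Lemma wact1 f : wact 1%g f = f.
Proof. by rewrite /wact invg1 repr_mx1 lsubst1. Qed.

Lemma wactK w : cancel (wact w) (wact w^-1%g).
Proof. by move=> f; rewrite -wactM mulVg wact1. Qed.

Lemma wactC w a : wact w a%:MP = a%:MP.
Proof. exact: lsubstC. Qed.

Variables (alpha : W -> 'rV[K]_n) (alphav : W -> 'cV[K]_n) (lambda : W -> K).
Hypothesis hroots : root_choice rho alpha alphav lambda.
Local Notation refl := (reflections rho).

Definition rmat s : 'M[K]_n := alphav s *m alpha s.
Definition kap s : K := (1 - lambda s) / 2%:R.

Lemma kap_neq0 s : s \in refl -> kap s != 0.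
Proof.
move=> /hroots[_ _ l1 _]; rewrite mulf_neq0 ?invr_eq0 ?pnatr_eq0 //.
by rewrite subr_eq0 eq_sym.
Qed.

Lemma root_pair s : s \in refl -> alpha s *m alphav s = 2%:R%:M.
Proof.
by move=> /hroots[_ _ _ p2]; rewrite [LHS]mx11_scalar -p2.
Qed.

Lemma root_neq0 s : s \in refl -> alpha s != 0.
Proof.
move=> sR; have [_ _ _] := hroots sR; apply: contra_eqN => /eqP->.
by rewrite /pairing mul0mx mxE eq_sym pnatr_eq0.
Qed.

Lemma rmat_sq s : s \in refl -> rmat s *m rmat s = 2%:R *: rmat s.
Proof.
move=> sR; rewrite /rmat mulmxA -(mulmxA (alphav s)) root_pair //.
by rewrite mul_mx_scalar scalemxAl.
Qed.

Lemma rmat_tr s : s \in refl -> \tr (rmat s) = 2%:R.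
Proof. by move=> sR; rewrite mxtrace_mulC root_pair // mxtrace_scalar. Qed.

(** A matrix of rank one having [alphav s] and [alpha s] as eigenvectors on the two sides
    for a nonzero eigenvalue is a multiple of [rmat s]. This holds for [rho s - 1]. *)
Lemma rho_reflV s : s \in refl -> rho s^-1%g = 1%:M - kap s *: rmat s.
Proof.
move=> sR; have [xl yl l1 p2] := hroots sR.
have l0 : lambda s != 0.
  apply: contra_neq (root_neq0 sR) => l0.
  by rewrite -[alpha s]dual_act1 -(mulVg s) dual_actM xl l0 scale0r /dual_act mul0mx.
pose B := rho s - 1%:M; pose mu := (lambda s)^-1 - 1.
have mu0 : mu != 0 by rewrite subr_eq0 invr_eq1.
have [u [r E]] : exists u : 'cV_n, exists r : 'rV_n, B = u *m r.
  move: sR; rewrite inE => /eqP rB.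
  move: (col_base B) (row_base B) (mulmx_base B); rewrite rB => u r <-.
  by exists u, r.
have Bv : B *m alphav s = mu *: alphav s.
  by rewrite mulmxBl mul1mx [rho s *m _]yl scalerBl scale1r.
have aB : alpha s *m B = mu *: alpha s.
  rewrite mulmxBr mulmx1 scalerBl scale1r; congr (_ - _).
  apply: (scalerI l0); rewrite scalerA divff // scale1r scalemxAl -xl.
  by rewrite -mulmxA rho_mulVr mulmx1.
have [t Et] : exists t, r *m alphav s = t%:M by exists ((r *m alphav s) 0 0); exact: mx11_scalar.
have [q Eq] : exists q, alpha s *m u = q%:M by exists ((alpha s *m u) 0 0); exact: mx11_scalar.
have ut : t *: u = mu *: alphav s by rewrite -Bv E -mulmxA Et mul_mx_scalar.
have qr : q *: r = mu *: alpha s by rewrite -aB E mulmxA Eq mul_scalar_mx.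
have tq : t * q = mu * 2%:R.
  have := congr1 (fun z => (alpha s *m z) 0 0) ut.
  by rewrite /= -!scalemxAr Eq root_pair // !mxE eqxx !mulr1n.
have two0 : (2%:R : K) != 0 by rewrite pnatr_eq0.
have EB : B = (mu / 2%:R) *: rmat s.
  have tq0 : t * q != 0 by rewrite tq mulf_neq0.
  apply: (scalerI tq0); rewrite E.
  have -> : (t * q) *: (u *m r) = (t *: u) *m (q *: r).
    by rewrite -scalemxAl -scalemxAr scalerA.
  rewrite ut qr -scalemxAl -scalemxAr !scalerA tq; congr (_ *: _).
  by field.
have inv : rho s *m (1%:M - kap s *: rmat s) = 1%:M.
  have -> : rho s = 1%:M + (mu / 2%:R) *: rmat s by rewrite -EB addrC subrK.
  rewrite mulmxDl mul1mx mulmxBr mulmx1 -scalemxAl -scalemxAr rmat_sq // !scalerA.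
  rewrite -[RHS]addr0 -addrA; congr (_ + _).
  rewrite -scaleNr -scalerBl -scalerDl.
  set k := (X in X *: _); suff -> : k = 0 by rewrite scale0r.
  rewrite /k /kap /mu.
  by field.
by rewrite -[LHS]mulmx1 -[X in _ *m X]inv mulmxA rho_mulVr mul1mx.
Qed.

Lemma dual_act_refl s x : s \in refl ->
  dual_act rho s x = x - (kap s * pairing (alphav s) x) *: alpha s.
Proof.
move=> sR; rewrite /dual_act rho_reflV // mulmxBr mulmx1; congr (_ - _).
rewrite -scalemxAr -scalerA mulmxA; congr (_ *: _).
by rewrite [x *m _]mx11_scalar mul_scalar_mx.
Qed.

Lemma act_reflV s y : s \in refl ->
  act rho s^-1%g y = y - (kap s * pairing y (alpha s)) *: alphav s.
Proof.
move=> sR; rewrite /act rho_reflV // mulmxBl mul1mx; congr (_ - _).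
rewrite -scalemxAl -scalerA -mulmxA; congr (_ *: _).
by rewrite [alpha s *m _]mx11_scalar mul_mx_scalar.
Qed.

Lemma reflJ s w : (s ^ w)%g \in refl = (s \in refl).
Proof.
have rJ t v : t \in refl -> (t ^ v)%g \in refl.
  rewrite !inE => /eqP rt; rewrite conjgE !rhoM.
  have -> : rho v^-1%g *m (rho t *m rho v) - 1%:M
     = rho v^-1%g *m ((rho t - 1%:M) *m rho v).
    by rewrite mulmxBl mul1mx mulmxBr rho_mulVr.
  rewrite -[X in X == _]mxrank_tr trmx_mul mxrankMfree; last first.
    by rewrite row_free_unit unitmx_tr repr_mx_unit ?inE.
  by rewrite mxrank_tr mxrankMfree ?rt // row_free_unit repr_mx_unit ?inE.
apply/idP/idP => [/(rJ _ w^-1%g)|]; last exact: rJ.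
by rewrite conjgK.
Qed.

(** Both [kap] and the rank-one matrix [rmat] are determined by the reflection:
    the first as half the trace of [1 - s^-1]. *)
Lemma kap_rmatJ s w : s \in refl ->
  kap (s ^ w)%g = kap s /\ rmat (s ^ w)%g = rho w^-1%g *m rmat s *m rho w.
Proof.
move=> sR; have sJ : (s ^ w)%g \in refl by rewrite reflJ.
have E : kap (s ^ w)%g *: rmat (s ^ w)%g = kap s *: (rho w^-1%g *m rmat s *m rho w).
  have := rho_reflV sJ; rewrite -conjVg conjgE !rhoM (rho_reflV sR) mulmxA.
  rewrite mulmxBr mulmx1 mulmxBl rho_mulVr => /addrI/oppr_inj <-.
  by rewrite -scalemxAr -scalemxAl.
have Ek : kap (s ^ w)%g = kap s.
  have := congr1 mxtrace E; rewrite !mxtraceZ rmat_tr // mxtrace_mulC mulmxA.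
  rewrite rho_mulV mul1mx rmat_tr //; apply: mulIf; by rewrite pnatr_eq0.
split=> //; apply: (scalerI (kap_neq0 sR)); by rewrite -E Ek.
Qed.

Variable c : W -> K.
Hypothesis hc : conj_invariant rho c.

Definition ccoef s y x := c s * pairing (alphav s) x * pairing y (alpha s).

Lemma ccoefE s y x : ccoef s y x = c s * (x *m rmat s *m y) 0 0.
Proof.
rewrite /ccoef /pairing /rmat -mulrA; congr (_ * _).
by rewrite !mulmxA [x *m _]mx11_scalar mul_scalar_mx -scalemxAl !mxE eqxx mulr1n.
Qed.

Lemma ccoefJ s w y x : s \in refl ->
  ccoef (s ^ w)%g y x = ccoef s (act rho w y) (dual_act rho w x).
Proof.
move=> sR; rewrite !ccoefE hc // (kap_rmatJ w sR).2 /act /dual_act.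
by rewrite !mulmxA.
Qed.

End Reflections.

(** * Dunkl operators *)

Section Dunkl.
Variables (K : numFieldType) (n : nat) (W : finGroupType).
Variable rho : mx_representation K [set: W]%G n.
Variables (alpha : W -> 'rV[K]_n) (alphav : W -> 'cV[K]_n) (lambda : W -> K).
Hypothesis hroots : root_choice rho alpha alphav lambda.
Variable c : W -> K.
Hypothesis hc : conj_invariant rho c.
Local Notation refl := (reflections rho).
Local Notation wact := (wact rho).
Local Notation act := (Defs.act rho).
Local Notation dual_act := (dual_act rho).
Local Notation kap := (kap lambda).
Local Notation ccoef := (ccoef alpha alphav c).
Implicit Types (w s : W) (x : 'rV[K]_n) (y : 'cV[K]_n) (f g : {mpoly K[n]}).

(** The two parts on the right are divisible by [alpha s]: the first by induction. *)
Lemma sub_wact_lform s x f : s \in refl ->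
  lform x * f - wact s (lform x * f) =
  lform x * (f - wact s f)
    + (kap s * pairing (alphav s) x) *: (lform (alpha s) * wact s f).
Proof.
move=> sR; rewrite rmorphM /= wact_lform (dual_act_refl hroots) //.
rewrite lformB lformZ mulrBl -scalerAl mulrBr.
by rewrite opprB addrCA addrC.
Qed.

Lemma rdiv_exists s f : s \in refl ->
  exists g, lform (alpha s) * g = (kap s)^-1 *: (f - wact s f).
Proof.
move=> sR; elim/lform_ind: f => [a|p q [g Eg] [h Eh]|x p [g Eg]].
- by exists 0; rewrite wactC subrr scaler0 mulr0.
- by exists (g + h); rewrite mulrDr Eg Eh -scalerDr [wact s (p + q)]raddfD opprD addrACA.
exists (lform x * g + pairing (alphav s) x *: wact s p).
rewrite mulrDr mulrCA Eg sub_wact_lform // [RHS]scalerDr scalerA mulKf ?(kap_neq0 hroots) //.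
by rewrite -!scalerAr.
Qed.

(** The divided difference attached to [s], normalised so that it satisfies the
    twisted Leibniz rule [rdiv_lform]. *)
Definition rdiv s f : {mpoly K[n]} :=
  xget 0 [set g | lform (alpha s) * g = (kap s)^-1 *: (f - wact s f)]%classic.

Lemma rdivE s f : s \in refl ->
  lform (alpha s) * rdiv s f = (kap s)^-1 *: (f - wact s f).
Proof.
move=> sR; have [g Eg] := rdiv_exists f sR.
pose D := [set g | lform (alpha s) * g = (kap s)^-1 *: (f - wact s f)]%classic.
exact: (@xgetPex _ 0 D (ex_intro _ g Eg)).
Qed.

Lemma rdiv_uniq s f g : s \in refl ->
  lform (alpha s) * g = (kap s)^-1 *: (f - wact s f) -> rdiv s f = g.
Proof.
move=> sR Eg; have /mulfI : lform (alpha s) != 0.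
  by rewrite lform_eq0 (root_neq0 hroots).
by apply; rewrite rdivE.
Qed.

Lemma rdiv_lin s a f g : s \in refl -> rdiv s (a *: f + g) = a *: rdiv s f + rdiv s g.
Proof.
move=> sR; apply: rdiv_uniq => //; rewrite mulrDr -scalerAr !rdivE //.
by rewrite linearP /= scalerA mulrC -scalerA -scalerDr scalerBr opprD addrACA.
Qed.

Lemma rdivD s f g : s \in refl -> rdiv s (f + g) = rdiv s f + rdiv s g.
Proof. by move=> sR; have := rdiv_lin 1 f g sR; rewrite !scale1r. Qed.

Lemma rdiv_inv s f : s \in refl -> wact s f = f -> rdiv s f = 0.
Proof. by move=> sR sf; apply: rdiv_uniq => //; rewrite sf subrr scaler0 mulr0. Qed.

Lemma rdiv_lform s x f : s \in refl ->
  rdiv s (lform x * f) = lform x * rdiv s f + pairing (alphav s) x *: wact s f.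
Proof.
move=> sR; apply: rdiv_uniq => //; rewrite mulrDr mulrCA rdivE // sub_wact_lform //.
by rewrite [RHS]scalerDr scalerA mulKf ?(kap_neq0 hroots) // -!scalerAr.
Qed.

Fact dunkl_key : unit. Proof. by []. Qed.
Definition dunkl y : {mpoly K[n]} -> {mpoly K[n]} := locked_with dunkl_key
  (fun f => dirder y f - \sum_(s in refl) (c s * pairing y (alpha s)) *: rdiv s f).

Lemma dunklE y f :
  dunkl y f = dirder y f - \sum_(s in refl) (c s * pairing y (alpha s)) *: rdiv s f.
Proof. by rewrite /dunkl unlock. Qed.

Lemma dunkl_is_linear y : linear (dunkl y).
Proof.
move=> a f g; rewrite !dunklE linearP /= scalerBr [RHS]addrACA -opprD; congr (_ - _).
rewrite scaler_sumr -big_split; apply: eq_bigr => s sR.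
by rewrite rdiv_lin // scalerDr !scalerA [a * _]mulrC.
Qed.
HB.instance Definition _ y := GRing.isLinear.Build K {mpoly K[n]} {mpoly K[n]}
  _ (dunkl y) (dunkl_is_linear y).

Lemma dunklD y : {morph dunkl y : f g / f + g}. Proof. exact: raddfD. Qed.
Lemma dunklB y : {morph dunkl y : f g / f - g}. Proof. exact: raddfB. Qed.
Lemma dunklZ y a f : dunkl y (a *: f) = a *: dunkl y f. Proof. exact: linearZ. Qed.
Lemma dunkl_sum y (P : pred W) (F : W -> {mpoly K[n]}) :
  dunkl y (\sum_(s | P s) F s) = \sum_(s | P s) dunkl y (F s).
Proof. exact: raddf_sum. Qed.
Lemma dunkl0 y : dunkl y 0 = 0. Proof. exact: raddf0. Qed.

Lemma dunklDl a y y' f : dunkl (a *: y + y') f = a *: dunkl y f + dunkl y' f.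
Proof.
rewrite !dunklE dirderDl dirderZl scalerBr [RHS]addrACA -opprD; congr (_ - _).
rewrite scaler_sumr -big_split; apply: eq_bigr => s sR.
by rewrite pairingDl mulrDr scalerDl mulrCA scalerA.
Qed.

Lemma dunklC y a : dunkl y a%:MP = 0.
Proof.
rewrite !dunklE dirderC big1 ?subr0 // => s sR.
by rewrite rdiv_inv ?scaler0 // wactC.
Qed.

Definition bracket y x f : {mpoly K[n]} :=
  pairing y x *: f - \sum_(s in refl) ccoef s y x *: wact s f.

Lemma dunkl_lform y x f :
  dunkl y (lform x * f) = lform x * dunkl y f + bracket y x f.
Proof.
rewrite !dunklE /bracket dirderM dirder_lform mul_mpolyC mulrBr.
rewrite [_ *: f + _]addrC [RHS]addrACA -opprD; congr (_ - _).
rewrite mulr_sumr -big_split; apply: eq_bigr => s sR.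
rewrite rdiv_lform // scalerDr -scalerAr scalerA.
by rewrite /Defs.pairing /ccoef mulrAC.
Qed.

(** The conjugation invariance of [c] enters here. *)
Lemma bracket_wact w y x f :
  wact w (bracket y x f) = bracket (act w y) (dual_act w x) (wact w f).
Proof.
rewrite /bracket linearB linearZ /= pairing_act; congr (_ - _).
rewrite linear_sum [RHS](reindex_inj (conjg_inj w^-1%g)) /=.
apply: eq_big => [s|s sR]; first by rewrite reflJ.
rewrite linearZ /= -(ccoefJ hroots hc) ?reflJ // conjgKV -!wactM.
by rewrite conjgE invgK !mulgA mulgKV.
Qed.

Lemma dunkl_wact w y f : wact w (dunkl y f) = dunkl (act w y) (wact w f).
Proof.
elim/lform_ind: f => [a|p q IHp IHq|x p IHp].
- by rewrite wactC !dunklC -mpolyC0 wactC.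
- by rewrite dunklD !wactD dunklD IHp IHq.
by rewrite wactMr wact_lform !dunkl_lform wactD wactMr IHp wact_lform bracket_wact.
Qed.

Lemma act_refl_sub s y : s \in refl ->
  act s y = (kap s * pairing (act s y) (alpha s)) *: alphav s + y.
Proof.
move=> sR; have := act_reflV hroots (act s y) sR.
by rewrite -actM mulVg act1 => {3}->; rewrite addrC subrK.
Qed.

Lemma pairing_root s y : s \in refl ->
  pairing y (alpha s) = lambda s * pairing (act s y) (alpha s).
Proof.
move=> sR; have [E _ _ _] := hroots sR.
by rewrite -(pairing_act rho s) E /pairing -scalemxAl mxE.
Qed.

(** The commutator of two Dunkl operators commutes with multiplication by linear
    forms, since [s] moves every vector along [alphav s]; as it kills the constants,
    it vanishes. *)
Lemma dunkl_comm y y' f : dunkl y (dunkl y' f) = dunkl y' (dunkl y f).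
Proof.
elim/lform_ind: f => [a|p q IHp IHq|x p IHp].
- by rewrite !dunklC ?dunkl0.
- by rewrite !dunklD IHp IHq.
rewrite 2!dunkl_lform (dunklD y) (dunklD y') 2!dunkl_lform IHp.
rewrite -[LHS]addrA -[RHS]addrA; congr (_ + _).
rewrite /bracket !dunklB !dunklZ.
rewrite [LHS]addrACA [RHS]addrACA -!opprD.
rewrite [_ *: dunkl y p + _]addrC; congr (_ - _); rewrite !dunkl_sum -!big_split /=.
apply: eq_bigr => s sR; rewrite !dunklZ !dunkl_wact.
have sub z : dunkl (act s z) (wact s p)
    = (kap s * pairing (act s z) (alpha s)) *: dunkl (alphav s) (wact s p) + dunkl z (wact s p).
  by rewrite {1}act_refl_sub // dunklDl.
rewrite !sub !scalerDr !scalerA -!addrA [X in _ + X]addrC; congr (_ *: _ + _).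
rewrite /ccoef (pairing_root y sR) (pairing_root y' sR).
by ring.
Qed.

End Dunkl.

(** * Structure of the rational Cherednik algebra *)

Section CherednikStructure.
Variables (K : numFieldType) (n : nat) (W : finGroupType).
Variable rho : mx_representation K [set: W]%G n.
Variables (alpha : W -> 'rV[K]_n) (alphav : W -> 'cV[K]_n) (lambda : W -> K).
Hypothesis hroots : root_choice rho alpha alphav lambda.
Variable c : W -> K.
Hypothesis hc : conj_invariant rho c.
Local Notation refl := (reflections rho).
Local Notation wact := (wact rho).
Local Notation act := (Defs.act rho).
Local Notation dual_act := (dual_act rho).
Local Notation ccoef := (ccoef alpha alphav c).
Local Notation H := (cherednik rho alpha alphav c).
Local Notation hrel := (cherednik_rel rho alpha alphav c).
Local Notation xH := (xH rho alpha alphav c).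
Local Notation yH := (yH rho alpha alphav c).
Local Notation wH := (wH rho alpha alphav c).
Local Notation eH := (eH rho alpha alphav c).
Local Notation rdiv := (rdiv rho alpha lambda).
Local Notation S := {mpoly K[n]}.
Implicit Types (w s : W) (x : 'rV[K]_n) (y : 'cV[K]_n) (f g p q : S) (z : H).

Lemma hscaleAl (a : K) (z z' : H) : a *: (z * z') = (a *: z) * z'.
Proof. exact: Defs.scaleAl. Qed.
Lemma hscaleAr (a : K) (z z' : H) : a *: (z * z') = z * (a *: z').
Proof. exact: Defs.scaleAr. Qed.
Lemma pscalE (a : K) : pscal hrel a = a *: (1 : H).
Proof. exact: pclassZ. Qed.

Lemma smash_eq (t t' : aterm K (cherednik_gen K n W)) :
  smash_rel rho t t' -> pclass hrel t = pclass hrel t'.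
Proof. by move=> tt'; apply/pclassP/acongr_rel; left. Qed.

Lemma xH_lin (a : K) x x' : xH (a *: x + x') = a *: xH x + xH x'.
Proof. by rewrite [LHS](smash_eq (smash_x _ a x x')) pclassD pclassM pclassZ -hscaleAl mul1r. Qed.

Lemma yH_lin (a : K) y y' : yH (a *: y + y') = a *: yH y + yH y'.
Proof. by rewrite [LHS](smash_eq (smash_y _ a y y')) pclassD pclassM pclassZ -hscaleAl mul1r. Qed.

Lemma wH1 : wH 1%g = 1.
Proof. by rewrite [LHS](smash_eq (smash_1 _)) pclassZ scale1r. Qed.

Lemma wHxH w x : wH w * xH x = xH (dual_act w x) * wH w.
Proof. by have := smash_eq (smash_Wx rho w x); rewrite !pclassM. Qed.

Lemma wHyH w y : wH w * yH y = yH (act w y) * wH w.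
Proof. by have := smash_eq (smash_Wy rho w y); rewrite !pclassM. Qed.

Let acomm_eq (t t' : aterm K (cherednik_gen K n W)) :
  hrel (acomm t t') (AScal 0) ->
  pclass hrel t * pclass hrel t' = pclass hrel t' * pclass hrel t.
Proof.
move=> tt'; have /pclassP := acongr_rel tt'.
rewrite /acomm pclassD !pclassM !pclassZ scale0r -hscaleAl mul1r scaleN1r.
exact: subr0_eq.
Qed.

Lemma xHC x x' : xH x * xH x' = xH x' * xH x.
Proof. by apply: acomm_eq; right; exact: comm_xx. Qed.

Lemma yHC y y' : yH y * yH y' = yH y' * yH y.
Proof. by apply: acomm_eq; right; exact: comm_yy. Qed.

Lemma xHZ (a : K) x : xH (a *: x) = a *: xH x.
Proof.
have x0 : xH 0 = 0.
  by have := xH_lin 1 0 0; rewrite !scale1r addr0 => /esym/(canRL (addrK _)); rewrite subrr.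
by have := xH_lin a x 0; rewrite x0 !addr0.
Qed.

Lemma yHZ (a : K) y : yH (a *: y) = a *: yH y.
Proof.
have y0 : yH 0 = 0.
  by have := yH_lin 1 0 0; rewrite !scale1r addr0 => /esym/(canRL (addrK _)); rewrite subrr.
by have := yH_lin a y 0; rewrite y0 !addr0.
Qed.

Lemma xHD x x' : xH (x + x') = xH x + xH x'.
Proof. by have := xH_lin 1 x x'; rewrite !scale1r. Qed.

Lemma yHD y y' : yH (y + y') = yH y + yH y'.
Proof. by have := yH_lin 1 y y'; rewrite !scale1r. Qed.

Let sD : {morph pscal hrel : a b / a + b >-> (a + b : H)}.
Proof. exact: pscalD. Qed.
Let sM : {morph pscal hrel : a b / a * b >-> (a * b : H)}.
Proof. exact: pscalM. Qed.
Let s1 : pscal hrel 1 = 1 :> H. Proof. by []. Qed.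
Let sC a (z : H) : (pscal hrel a : H) * z = z * pscal hrel a.
Proof. exact: pscalC. Qed.

Fact XH_key : unit. Proof. by []. Qed.
(** The embeddings of [S(h^* )] and [S(h)]; the variables of the second one are the
    standard basis of [h], so that the linear form with coefficients [y^T] goes to [y]. *)
Definition XH : S -> H := locked_with XH_key
  (ceval (A := H) (pscal hrel) (fun i => xH (delta_mx 0 i))).
Definition YH : S -> H := locked_with XH_key
  (ceval (A := H) (pscal hrel) (fun i => yH (delta_mx i 0))).

Lemma XHD : {morph XH : f g / f + g}.
Proof. by rewrite /XH unlock; apply: cevalD. Qed.
Lemma XHM : {morph XH : f g / f * g}.
Proof. by rewrite /XH unlock; apply: cevalM => // i j; exact: xHC. Qed.
Lemma XHC (a : K) : XH a%:MP = a *: (1 : H).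
Proof. by rewrite /XH unlock cevalC // pscalE. Qed.
Lemma XH_X i : XH 'X_i = xH (delta_mx 0 i).
Proof. by rewrite /XH unlock cevalX // => j k; exact: xHC. Qed.
Lemma YHD : {morph YH : f g / f + g}.
Proof. by rewrite /YH unlock; apply: cevalD. Qed.
Lemma YHM : {morph YH : f g / f * g}.
Proof. by rewrite /YH unlock; apply: cevalM => // i j; exact: yHC. Qed.
Lemma YHC (a : K) : YH a%:MP = a *: (1 : H).
Proof. by rewrite /YH unlock cevalC // pscalE. Qed.
Lemma YH_X i : YH 'X_i = yH (delta_mx i 0).
Proof. by rewrite /YH unlock cevalX // => j k; exact: yHC. Qed.

Lemma XH0 : XH 0 = 0. Proof. by rewrite -mpolyC0 XHC scale0r. Qed.
Lemma YH0 : YH 0 = 0. Proof. by rewrite -mpolyC0 YHC scale0r. Qed.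
Lemma XH1 : XH 1 = 1. Proof. by rewrite -mpolyC1 XHC scale1r. Qed.
Lemma YH1 : YH 1 = 1. Proof. by rewrite -mpolyC1 YHC scale1r. Qed.
Lemma XHZ (a : K) f : XH (a *: f) = a *: XH f.
Proof. by rewrite -mul_mpolyC XHM XHC -hscaleAl mul1r. Qed.
Lemma YHZ (a : K) f : YH (a *: f) = a *: YH f.
Proof. by rewrite -mul_mpolyC YHM YHC -hscaleAl mul1r. Qed.
Lemma XHB : {morph XH : f g / f - g}.
Proof. by move=> f g; rewrite -scaleN1r XHD XHZ scaleN1r. Qed.
Lemma XH_sum (I : finType) (P : pred I) (F : I -> S) :
  XH (\sum_(i | P i) F i) = \sum_(i | P i) XH (F i).
Proof. exact: (big_morph XH XHD XH0). Qed.
Lemma YH_sum (I : finType) (P : pred I) (F : I -> S) :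
  YH (\sum_(i | P i) F i) = \sum_(i | P i) YH (F i).
Proof. exact: (big_morph YH YHD YH0). Qed.
Lemma XHXH f g : XH f * XH g = XH g * XH f.
Proof. by rewrite -!XHM mulrC. Qed.
Lemma YHYH f g : YH f * YH g = YH g * YH f.
Proof. by rewrite -!YHM mulrC. Qed.

Lemma XH_lform x : XH (lform x) = xH x.
Proof.
have x0 : xH 0 = 0 by rewrite -(scale0r 0) xHZ scale0r.
rewrite [in RHS](row_sum_delta x) (big_morph xH xHD x0) /lform XH_sum.
by apply: eq_bigr => i _; rewrite XHZ XH_X xHZ.
Qed.

Lemma YH_lform y : YH (lform y^T) = yH y.
Proof.
have y0 : yH 0 = 0 by rewrite -(scale0r 0) yHZ scale0r.
rewrite -[in RHS](trmxK y) [in RHS](row_sum_delta y^T) [in RHS]linear_sum /=.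
rewrite (big_morph yH yHD y0) /lform YH_sum.
by apply: eq_bigr => i _; rewrite linearZ /= trmx_delta YHZ YH_X yHZ.
Qed.

Lemma wHXH w f : wH w * XH f = XH (wact w f) * wH w.
Proof.
elim/lform_ind: f => [a|p q IHp IHq|x p IHp].
- by rewrite wactC XHC -hscaleAl -hscaleAr mulr1 mul1r.
- by rewrite wactD !XHD mulrDr mulrDl IHp IHq.
by rewrite wactMr !XHM mulrA !XH_lform wact_lform XH_lform wHxH -!mulrA IHp.
Qed.

(** The action of [W] on [S(h)]; [YH] reads the coefficients of a linear form as a column,
    whence the transpose. *)
Definition wsub w : S -> S := lsubst (rho w)^T.

Lemma wHYH w q : wH w * YH q = YH (wsub w q) * wH w.
Proof.
rewrite /wsub; elim/lform_ind: q => [a|p q IHp IHq|x p IHp].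
- by rewrite lsubstC YHC -hscaleAl -hscaleAr mulr1 mul1r.
- by rewrite raddfD /= !YHD mulrDr mulrDl IHp IHq.
rewrite rmorphM /= !YHM mulrA lsubst_lform -(trmxK x) -trmx_mul !YH_lform wHyH.
by rewrite -!mulrA IHp.
Qed.

(** The defining relation between [y] and [x] extends to products by the Leibniz rules of
    [dirder] and [rdiv]. *)
Lemma yHXH y f : yH y * XH f = XH f * yH y + XH (dirder y f)
  - \sum_(s in refl) (c s * pairing y (alpha s)) *: (XH (rdiv s f) * wH s).
Proof.
elim/lform_ind: f => [a|p q IHp IHq|x p IHp].
- rewrite dirderC XH0 addr0 big1 ?subr0 => [|s sR].
    by rewrite XHC -hscaleAl -hscaleAr mulr1 mul1r.
  by rewrite (rdiv_inv hroots) ?wactC // XH0 mul0r scaler0.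
- rewrite raddfD /= !XHD mulrDr mulrDl IHp IHq addrACA -opprD; congr (_ - _).
    by rewrite addrACA.
  rewrite -big_split /=; apply: eq_bigr => s sR.
  by rewrite (rdivD hroots) // XHD mulrDl scalerDr.
rewrite XHM mulrA XH_lform.
have -> : yH y * xH x = xH x * yH y + (pairing y x *: (1 : H) -
    \sum_(s in refl) ccoef s y x *: wH s).
  by rewrite -yHxH addrC subrK.
rewrite mulrDl -mulrA IHp mulrBl -hscaleAl mul1r mulrBr mulrDr mulrA.
rewrite dirderM dirder_lform XHD !XHM XHC XH_lform -hscaleAl mul1r.
rewrite addrACA -opprD; congr (_ - _); first by rewrite -addrA [X in _ + X]addrC.
rewrite mulr_sumr mulr_suml -big_split /=; apply: eq_bigr => s sR.
rewrite (rdiv_lform hroots) // XHD XHM XH_lform mulrDl scalerDr -mulrA -hscaleAr.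
congr (_ + _); rewrite -hscaleAl wHXH XHZ -hscaleAl scalerA; congr (_ *: _).
by rewrite /Defs.pairing mulrAC.
Qed.

(** Divided differences vanish on invariants, on which [y] acts as a plain derivation. *)
Lemma yHXH_inv y p : (forall w, wact w p = p) ->
  yH y * XH p = XH p * yH y + XH (dirder y p).
Proof.
move=> pW; rewrite yHXH big1 ?subr0 // => s sR.
by rewrite (rdiv_inv hroots) // XH0 mul0r scaler0.
Qed.

(** ** The polynomial representation *)

Definition gen_act (k : cherednik_gen K n W) (f : S) : S :=
  match k with
  | GX x => lform x * f
  | GY y => dunkl rho alpha lambda c y f
  | GW w => wact w f
  end.

Lemma gen_act_lin (k : cherednik_gen K n W) : linear (gen_act k).
Proof.
case: k => [x|y|w] a f f' /=; last exact: linearP.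
  by rewrite mulrDr scalerAr.
by rewrite (dunklD hroots) (dunklZ hroots).
Qed.

Let asum_act (r : seq (aterm K (cherednik_gen K n W))) f :
  term_act gen_act (asum r) f = \sum_(t <- r) term_act gen_act t f.
Proof. by elim: r => [|t r IHr]; rewrite ?big_nil ?big_cons /= ?scale0r ?IHr. Qed.

Lemma gen_act_rel t t' : hrel t t' -> term_act gen_act t =1 term_act gen_act t'.
Proof.
case=> [[a x x'|a y y'||w w'|w x|w y]|[x x'|y y'|y x]] f /=.
- by rewrite lformD lformZ mulrDl scalerAl.
- exact: dunklDl.
- by rewrite wact1 scale1r.
- exact: wactM.
- by rewrite wactMr wact_lform.
- exact: (dunkl_wact hroots hc).
- by rewrite mulrCA scaleN1r subrr scale0r.
- by rewrite (dunkl_comm hroots hc) scaleN1r subrr scale0r.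
rewrite (dunkl_lform hroots) !scaleN1r addrC addKr /bracket; congr (_ - _).
by rewrite asum_act big_map big_enum.
Qed.

Definition poly_act : H -> S -> S := palg_act (rel := hrel) gen_act.

Lemma poly_actM z z' f : poly_act (z * z') f = poly_act z (poly_act z' f).
Proof. exact: palg_actM gen_act_lin gen_act_rel _ _ _. Qed.

Lemma poly_act_XH f g : poly_act (XH f) g = f * g.
Proof.
elim/lform_ind: f => [a|p q IHp IHq|x p IHp].
- rewrite XHC mul_mpolyC [LHS](palg_actZl gen_act_lin gen_act_rel); congr (_ *: _).
  by rewrite -[LHS]/(poly_act 1 g) -[1 in LHS]/(pscal hrel 1)
    [LHS](palg_act_scal gen_act_lin gen_act_rel) scale1r.
- by rewrite XHD mulrDl -IHp -IHq; exact: palg_actDl gen_act_lin gen_act_rel _ _ _.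
rewrite XHM poly_actM IHp XH_lform -mulrA.
exact: palg_act_gen gen_act_lin gen_act_rel _ _.
Qed.

Lemma poly_act_eH : poly_act eH 1 = 1.
Proof.
have act0 f : poly_act 0 f = 0 by rewrite -XH0 poly_act_XH mul0r.
rewrite /eH [LHS](palg_actZl gen_act_lin gen_act_rel).
have -> : palg_act gen_act (\sum_w wH w : H) 1 = \sum_(w : W) (1 : S).
  rewrite -/(poly_act _ _) (big_morph (poly_act^~ 1) (id1 := 0) (op1 := +%R)) //.
    apply: eq_bigr => w _; rewrite [LHS](palg_act_gen gen_act_lin gen_act_rel) /=.
    by rewrite -mpolyC1 wactC.
  by move=> z z'; exact: palg_actDl gen_act_lin gen_act_rel _ _ _.
rewrite sumr_const -scaler_nat scalerA mulVf ?scale1r //.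
by rewrite pnatr_eq0 -lt0n; apply/card_gt0P; exists 1%g.
Qed.

(** [fe] sends the constant [1] of the polynomial representation to [f]. *)
Lemma XHeH_eq0 f : XH f * eH = 0 -> f = 0.
Proof.
move=> /(congr1 (poly_act^~ 1)); rewrite /= poly_actM poly_act_eH poly_act_XH mulr1 => ->.
by rewrite -XH0 poly_act_XH mul0r.
Qed.

Lemma XH_eq0 f : XH f = 0 -> f = 0.
Proof. by move=> f0; apply: XHeH_eq0; rewrite f0 mul0r. Qed.

(** ** The symmetrising idempotent and the generation of [H] *)

Lemma wHeH w : wH w * eH = eH.
Proof.
rewrite /eH -hscaleAr mulr_sumr; congr (_ *: _).
rewrite [RHS](reindex_inj (mulgI w)) /=.
by apply: eq_bigr => w' _; rewrite wHM.
Qed.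

Lemma eHwH w : eH * wH w = eH.
Proof.
rewrite /eH -hscaleAl mulr_suml; congr (_ *: _).
rewrite [RHS](reindex_inj (mulIg w)) /=.
by apply: eq_bigr => w' _; rewrite wHM.
Qed.

Lemma eHXH p : (forall w, wact w p = p) -> eH * XH p = XH p * eH.
Proof.
move=> pW; rewrite /eH -hscaleAl -hscaleAr mulr_suml mulr_sumr; congr (_ *: _).
by apply: eq_bigr => w _; rewrite wHXH pW.
Qed.

Lemma cherednik_ind (P : H -> Prop) :
    P 1 -> (forall z z', P z -> P z' -> P (z + z')) ->
    (forall a z, P z -> P (a *: z)) -> (forall x z, P z -> P (xH x * z)) ->
    (forall y z, P z -> P (yH y * z)) -> (forall w z, P z -> P (wH w * z)) ->
  forall z, P z.
Proof.
move=> P1 PD PZ Px Py Pw z.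
suff: forall t z', P z' -> P (pclass hrel t * z').
  by move=> Pt; elim/palg_ind: z => t; rewrite -[pclass _ _]mulr1; exact: Pt.
elim=> {z} [[x|y|w]|a|t IHt t' IHt'|t IHt t' IHt'] z Pz.
- exact: Px.
- exact: Py.
- exact: Pw.
- by rewrite pclassZ -hscaleAl mul1r; exact: PZ.
- by rewrite pclassD mulrDl; apply: PD; [exact: IHt|exact: IHt'].
by rewrite pclassM -mulrA; exact/IHt/IHt'.
Qed.

Lemma SdualP z : Sdual z <-> exists f, z = XH f.
Proof.
split=> [Sz|[f ->] B [[B1 BL BM] BX]].
  apply: (Sz [set z | exists f, z = XH f]%classic); split=> [|_ [x _ <-]].
    split=> [|a _ _ [f ->] [g ->]|_ _ [f ->] [g ->]].
    - by exists 1; rewrite XH1.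
    - by exists (a *: f + g); rewrite XHD XHZ.
    by exists (f * g); rewrite XHM.
  by exists (lform x); rewrite XH_lform.
have B0 : B 0.
  by have := BL (-1) 1 1 B1 B1; rewrite scaleN1r addNr.
have BZ a u : B u -> B (a *: u) by move=> Bu; have := BL a u 0 Bu B0; rewrite addr0.
elim/lform_ind: f => [a|p q IHp IHq|x p IHp].
- by rewrite XHC; exact: BZ.
- by rewrite XHD -[XH p]scale1r; exact: BL.
by rewrite XHM; apply: BM => //; apply: BX; exists x; rewrite ?XH_lform.
Qed.

End CherednikStructure.

(** * Invariant polynomials *)

Section Invariants.
Variables (K : numFieldType) (n : nat) (W : finGroupType).
Variable rho : mx_representation K [set: W]%G n.
Local Notation wact := (wact rho).
Local Notation S := {mpoly K[n]}.
Implicit Types (w : W) (f g p : S).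

Definition invariant p := forall w, wact w p = p.

(** This makes [S] integral over the invariants: it is monic, has [g] as a root, and [W]
    permutes its factors. *)
Definition orbit_poly g : {poly S} := \prod_(w : W) ('X - (wact w g)%:P).

Lemma orbit_poly_size g : size (orbit_poly g) = #|W|.+1.
Proof. by rewrite size_prod_XsubC [index_enum _]unlock -enumT -cardT. Qed.

Lemma orbit_poly_monic g : orbit_poly g \is monic.
Proof. exact: monic_prod_XsubC. Qed.

Lemma orbit_poly_root g : (orbit_poly g).[g] = 0.
Proof.
rewrite /orbit_poly (bigD1 1%g) //= wact1 hornerM hornerXsubC subrr mul0r //.
Qed.

Lemma orbit_poly_inv g i : invariant (orbit_poly g)`_i.
Proof.
move=> v; rewrite -[LHS](coef_map (wact v)); congr (nth _ (polyseq _) _).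
rewrite rmorph_prod /= /orbit_poly [RHS](reindex_inj (mulgI v)) /=.
by apply: eq_bigr => w _; rewrite rmorphB /= map_polyX map_polyC /= -wactM.
Qed.

(** Let [r] be the polynomial [orbit_poly g]. Since [d] kills the coefficients of [r], it
    maps [r^(j)(g)] to [r^(j+1)(g) d(g)]. If [d(g)] were nonzero, all [r^(j)(g)] would
    vanish, starting from [r(g)]; but the last nonzero derivative of [r] is a constant. *)
Lemma derivation_inv_eq0 (d : S -> S) :
    {morph d : f g / f + g} -> (forall f g, d (f * g) = d f * g + f * d g) ->
    (forall p, invariant p -> d p = 0) ->
  forall g, d g = 0.
Proof.
move=> dD dM dinv g.
have d0 : d 0 = 0 by apply: (@addrI _ (d 0)); rewrite -dD !addr0.
have dsum (r : seq nat) (F : nat -> S) : d (\sum_(i <- r) F i) = \sum_(i <- r) d (F i).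
  exact: (big_morph d dD d0).
have d1 : d 1 = 0 by apply: dinv => w; rewrite rmorph1.
have dX k : d (g ^+ k) = g ^+ k.-1 *+ k * d g.
  elim: k => [|k IHk]; first by rewrite expr0 d1 mulr0n mul0r.
  rewrite exprS dM IHk /= mulrS mulrDl mulrC; congr (_ + _).
  case: k {IHk} => [|k]; first by rewrite !mulr0n !(mul0r, mulr0).
  by rewrite mulrA mulrnAr -exprS.
pose P (r : {poly S}) := forall i, d r`_i = 0.
have dhorner r : P r -> d r.[g] = r^`().[g] * d g.
  move=> Pr; rewrite (horner_coef_wide _ (leqnn (size r))).
  rewrite -(big_mkord xpredT (fun i => r`_i * g ^+ i)) dsum.
  rewrite (@horner_coef_wide _ (size r).-1 r^`()); last first.
    have [->|r0] := eqVneq r 0; rewrite ?deriv0 ?size_poly0 //.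
    by rewrite -ltnS prednK ?size_poly_gt0 // lt_size_deriv.
  rewrite mulr_suml; case: (size r) => [|k]; first by rewrite big_geq // big_ord0.
  rewrite big_nat_recl // dM Pr expr0 d1 mul0r mulr0 !add0r /= big_mkord.
  apply: eq_bigr => i _; rewrite dM Pr mul0r add0r dX coef_deriv /=.
  by rewrite mulrA mulrnAr !mulrnAl.
have [//|dg0] := eqVneq (d g) 0.
pose r := orbit_poly g.
have Pr j : P r^`(j).
  elim: j => [|j IHj] i; first by apply: dinv; exact: orbit_poly_inv.
  rewrite derivnS coef_deriv; move: (IHj i.+1); move: (_`_i.+1) => f df0.
  by elim: i.+1 => [|k IHk]; rewrite ?mulr0n // mulrS dD df0 IHk addr0.
have r0 j : r^`(j).[g] = 0.
  elim: j => [|j IHj]; first exact: orbit_poly_root.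
  have := dhorner _ (Pr j); rewrite IHj d0 -derivnS => /esym/eqP.
  by rewrite mulf_eq0 (negPf dg0) orbF => /eqP.
have := r0 #|W|.
have -> : r^`(#|W|) = ((#|W|)`!%:R)%:P.
  apply/polyP => i; rewrite coef_derivn coefC; case: i => [|i] /=.
    rewrite addn0 ffactnn; have := orbit_poly_monic g.
    by rewrite monicE lead_coefE orbit_poly_size /= => /eqP->.
  by rewrite nth_default ?mul0rn // orbit_poly_size addnS ltnS leq_addr.
rewrite hornerC => /eqP; rewrite -mpolyC_nat mpolyC_eq0 pnatr_eq0.
by rewrite -leqn0 leqNgt fact_gt0.
Qed.

Definition bounded_mnm (a : {ffun 'I_n -> 'I_#|W|}) : S := \prod_i 'X_i ^+ a i.

(** Each variable is a root of a monic polynomial of degree [#|W|] with invariant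
    coefficients, which reduces the exponents one variable at a time. *)
Lemma integral_span f :
  exists2 p : {ffun 'I_n -> 'I_#|W|} -> S, forall a, invariant (p a)
    & f = \sum_a p a * bounded_mnm a.
Proof.
pose spanned g := exists2 p : {ffun 'I_n -> 'I_#|W|} -> S, forall a, invariant (p a)
    & g = \sum_a p a * bounded_mnm a.
have W0 : (0 < #|W|)%N by apply/card_gt0P; exists 1%g.
have invC a : invariant a%:MP by move=> w; rewrite wactC.
have spD g h : spanned g -> spanned h -> spanned (g + h).
  case=> [p pi ->] [q qi ->]; exists (fun a => p a + q a).
    by move=> a w; rewrite wactD pi qi.
  by rewrite -big_split; apply: eq_bigr => a _; rewrite mulrDl.
have spM p g : invariant p -> spanned g -> spanned (p * g).
  move=> pi [q qi ->]; exists (fun a => p * q a); first by move=> a w; rewrite wactMr pi qi.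
  by rewrite mulr_sumr; apply: eq_bigr => a _; rewrite mulrA.
have sp_sum (I : finType) (F : I -> S) : (forall i, spanned (F i)) -> spanned (\sum_i F i).
  move=> spF; elim/big_ind: _ => //; exists (fun=> 0); first by move=> a w; rewrite rmorph0.
  by rewrite big1 // => a _; rewrite mul0r.
have sp1 a : spanned (bounded_mnm a).
  exists (fun b => (b == a)%:R%:MP) => [b|]; first exact: invC.
  rewrite (bigD1 a) //= eqxx mpolyC1 mul1r big1 ?addr0 // => b /negPf->.
  by rewrite mpolyC0 mul0r.
(* multiplying a bounded monomial by a variable yields an exponent of #|W| at worst *)
have spX i k (a : {ffun 'I_n -> 'I_#|W|}) : (k <= #|W|)%N ->
    spanned ('X_i ^+ k * \prod_(j | j != i) 'X_j ^+ a j).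
  have lt_sp l : (l < #|W|)%N -> spanned ('X_i ^+ l * \prod_(j | j != i) 'X_j ^+ a j).
    move=> lW; have := sp1 [ffun j => if j == i then Ordinal lW else a j].
    rewrite /bounded_mnm (bigD1 i) //= ffunE eqxx /=.
    rewrite (eq_bigr (fun j => 'X_j ^+ a j)) // => j /negPf ji.
    by rewrite ffunE ji.
  rewrite leq_eqVlt => /predU1P[->|]; last exact: lt_sp.
  have := orbit_poly_root 'X_i; rewrite (horner_coef_wide _ (leqnn _)) orbit_poly_size.
  rewrite big_ord_recr /=; have := orbit_poly_monic 'X_i.
  rewrite monicE lead_coefE orbit_poly_size /= => /eqP->; rewrite mul1r addrC.
  move/eqP; rewrite addr_eq0 => /eqP->; rewrite -mulN1r -mulrA mulr_suml.
  apply: (spM _ _); first by move=> w; rewrite rmorphN1.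
  by apply: (sp_sum) => l; rewrite -mulrA; apply: (spM _ _); [exact: orbit_poly_inv|exact: lt_sp].
elim/mpoly_mul_ind: f => [a|p q|i p [q qi ->]]; last 1 first.
- rewrite mulr_sumr; apply: (sp_sum) => a; rewrite mulrCA; apply: (spM _ _) => //.
  by rewrite /bounded_mnm (bigD1 i) //= mulrA -exprS; exact: spX.
- rewrite -[_%:MP]mulr1; apply: (spM _ _) => //.
  have := sp1 [ffun=> Ordinal W0]; rewrite /bounded_mnm big1 // => j _.
  by rewrite ffunE expr0.
exact: spD.
Qed.

Lemma exists_moved w : mx_faithful rho -> w != 1%g ->
  exists x : 'rV_n, dual_act rho w x != x.
Proof.
move=> faith w1; apply: contrapT => nofix; move/eqP: w1; apply.
have rw1 : rho w^-1%g = 1%:M.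
  apply/row_matrixP => i; rewrite rowE [RHS]rowE mulmx1; apply/eqP/negPn/negP => moved.
  by apply: nofix; exists (delta_mx 0 i).
have : w^-1%g \in rker rho by apply/rkerP; rewrite inE.
by move/(fintype.subsetP faith)/set1P/eqP; rewrite eq_invg1 => /eqP.
Qed.

End Invariants.

(** * The algebra as a module over [S(h^* )] on the left and [S(h)] on the right *)

(** The bounds on degrees below are proved coefficientwise; [msize] is one more than the
    degree, so that [k] bounds the degree strictly. *)
Lemma msize_leP n (R : nzRingType) (u : {mpoly R[n]}) k :
  (msize u <= k)%N <-> (forall m, (k <= mdeg m)%N -> u@_m = 0).
Proof.
split=> [uk m km|u0].
  by apply: memN_msupp_eq0; apply: msize_mdeg_ge; exact: leq_trans km.
rewrite msizeE; apply/bigmax_leqP_seq => m mu _.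
by rewrite ltnNge; apply: contraL mu => km; rewrite mcoeff_msupp u0 ?eqxx.
Qed.

Lemma msizeM_leS n (R : nzRingType) (u v : {mpoly R[n]}) k l :
  (msize u <= k.+1 -> msize v <= l.+1 -> msize (u * v) <= (k + l).+1)%N.
Proof.
move=> uk vl; apply/msize_leP => m klm; rewrite mcoeffM big1 // => -[m1 m2] /= /eqP E.
have [k1|k1] := ltnP k (mdeg m1).
  by rewrite (proj1 (msize_leP _ _) uk) ?mul0r.
rewrite [X in _ * X](proj1 (msize_leP _ _) vl) ?mulr0 //.
have klm' : (k + l < mdeg m1 + mdeg m2)%N by rewrite -mdegD -E.
by rewrite -(ltn_add2l (mdeg m1)); exact: leq_ltn_trans (leq_add k1 (leqnn l)) klm'.
Qed.

Lemma msize_lsubst (K : numFieldType) n (A : 'M[K]_n) f :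
  (msize (lsubst A f) <= msize f)%N.
Proof.
have lf x : (msize (lform x : {mpoly K[n]}) <= 2)%N.
  apply/msize_leP => m m2; rewrite /lform raddf_sum big1 // => i _.
  rewrite /= mcoeffZ mcoeffX; have [mE|] := eqVneq; last by rewrite mulr0.
  by move: m2; rewrite -mE mdeg1.
rewrite [f in lsubst A f]mpolyE raddf_sum /=; apply: leq_trans (msize_sum _ _ _) _.
apply/bigmax_leqP_seq => m mf _; rewrite linearZ /=.
apply: leq_trans (msizeZ_le _ _) (leq_trans _ (msize_mdeg_lt mf)).
rewrite lsubstE comp_mpolyX mdegE.
apply: (big_ind2 (fun (u : {mpoly K[n]}) k => (msize u <= k.+1)%N)).
- by rewrite msize1.
- by move=> u1 k1 u2 k2; exact: msizeM_leS.
move=> i _; rewrite tnth_mktuple; elim: (m i) => [|k IHk]; first by rewrite msize1.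
by rewrite exprS; exact: (@msizeM_leS _ _ _ _ 1 k).
Qed.

Section BimoduleAction.
Variables (K : numFieldType) (n : nat) (W : finGroupType).
Variable rho : mx_representation K [set: W]%G n.
Variables (alpha : W -> 'rV[K]_n) (alphav : W -> 'cV[K]_n) (lambda : W -> K).
Hypothesis hroots : root_choice rho alpha alphav lambda.
Variable c : W -> K.
Local Notation wsub := (wsub rho).
Local Notation act := (Defs.act rho).
Local Notation H := (cherednik rho alpha alphav c).
Local Notation yH := (yH rho alpha alphav c).
Local Notation wH := (wH rho alpha alphav c).
Local Notation eH := (eH rho alpha alphav c).
Local Notation XH := (XH rho alpha alphav c).
Local Notation YH := (YH rho alpha alphav c).
Local Notation S := {mpoly K[n]}.
Local Notation L := {mpoly {mpoly K[n]}[n]}.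
Implicit Types (w s : W) (x : 'rV[K]_n) (y : 'cV[K]_n) (f g p q : S) (u v : L) (z : H).

Fact bact_key : unit. Proof. by []. Qed.
(** [L] is [S(h^* ) (x) S(h)]: its coefficients act by left multiplication and its
    variables by right multiplication. *)
Definition bact : L -> H -> H := locked_with bact_key
  (opact (fun f z => XH f * z) (fun i z => z * yH (delta_mx i 0))).

Let sD f g z : XH (f + g) * z = XH f * z + XH g * z.
Proof. by rewrite XHD mulrDl. Qed.
Let sDr f : {morph (fun z => XH f * z) : z z' / z + z'}.
Proof. by move=> z z'; rewrite mulrDr. Qed.
Let s1 z : XH 1 * z = z. Proof. by rewrite XH1 mul1r. Qed.
Let sM f g z : XH (f * g) * z = XH f * (XH g * z).
Proof. by rewrite XHM mulrA. Qed.
Let tD i : {morph (fun z => z * yH (delta_mx i 0)) : z z' / z + z'}.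
Proof. by move=> z z'; rewrite mulrDl. Qed.
Let tC i j z : z * yH (delta_mx j 0) * yH (delta_mx i 0)
  = z * yH (delta_mx i 0) * yH (delta_mx j 0).
Proof. by rewrite -!mulrA yHC. Qed.
Let ts i f z : XH f * z * yH (delta_mx i 0) = XH f * (z * yH (delta_mx i 0)).
Proof. by rewrite mulrA. Qed.

Lemma bactDl u v z : bact (u + v) z = bact u z + bact v z.
Proof. by rewrite /bact unlock opactDl. Qed.
Lemma bactDr u : {morph bact u : z z' / z + z'}.
Proof. by rewrite /bact unlock; apply: opactDr. Qed.
Lemma bactM u v z : bact (u * v) z = bact u (bact v z).
Proof. by rewrite /bact unlock opactM. Qed.
Lemma bactC f z : bact f%:MP z = XH f * z.
Proof. by rewrite /bact unlock opactC. Qed.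
Lemma bactX i z : bact 'X_i z = z * yH (delta_mx i 0).
Proof. by rewrite /bact unlock opactX. Qed.
Lemma bact0l z : bact 0 z = 0.
Proof. by rewrite -mpolyC0 bactC XH0 mul0r. Qed.
Lemma bact1 z : bact 1 z = z.
Proof. by rewrite -mpolyC1 bactC XH1 mul1r. Qed.
Lemma bact0r u : bact u 0 = 0.
Proof. by apply: (@addrI _ (bact u 0)); rewrite -bactDr !addr0. Qed.
Lemma bactN u z : bact (- u) z = - bact u z.
Proof. by apply: (@addrI _ (bact u z)); rewrite -bactDl !subrr bact0l. Qed.
Lemma bact_suml (I : Type) (r : seq I) (P : pred I) (F : I -> L) z :
  bact (\sum_(i <- r | P i) F i) z = \sum_(i <- r | P i) bact (F i) z.
Proof. exact: (big_morph (bact^~ z) (fun u v => bactDl u v z) (bact0l z)). Qed.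
Lemma bact_sumr (I : Type) (r : seq I) (P : pred I) u (F : I -> H) :
  bact u (\sum_(i <- r | P i) F i) = \sum_(i <- r | P i) bact u (F i).
Proof. exact: (big_morph (bact u) (bactDr u) (bact0r u)). Qed.

(** [S(h)] inside [L]. *)
Definition lift_y : S -> L := locked_with bact_key (map_mpoly (@mpolyC n K)).

Lemma lift_yD : {morph lift_y : p q / p + q}.
Proof. by move=> p q; rewrite /lift_y unlock raddfD. Qed.
Lemma lift_yM : {morph lift_y : p q / p * q}.
Proof. by move=> p q; rewrite /lift_y unlock rmorphM. Qed.
Lemma lift_yC a : lift_y a%:MP = a%:MP%:MP.
Proof. by rewrite /lift_y unlock map_mpolyC. Qed.
Lemma lift_yX m : lift_y 'X_[m] = 'X_[m].
Proof. by rewrite /lift_y unlock map_mpolyX. Qed.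
Lemma mcoeff_lift_y q m : (lift_y q)@_m = (q@_m)%:MP.
Proof. by rewrite /lift_y unlock mcoeff_map_mpoly. Qed.

Lemma bact_lift q z : bact (lift_y q) z = z * YH q.
Proof.
elim/mpoly_mul_ind: q => [a|p q IHp IHq|i p IHp].
- by rewrite lift_yC bactC XHC YHC -hscaleAl -hscaleAr mulr1 mul1r.
- by rewrite lift_yD bactDl IHp IHq YHD mulrDr.
by rewrite lift_yM lift_yX bactM IHp bactX YHM YHYH YH_X mulrA.
Qed.

Lemma bactZX f m z : bact (f *: 'X_[m]) z = XH f * z * YH 'X_[m].
Proof.
rewrite -mul_mpolyC bactM bactC -mulrA; congr (_ * _).
by rewrite -bact_lift lift_yX.
Qed.

Lemma bactE u z : bact u z = \sum_(m <- msupp u) XH u@_m * z * YH 'X_[m].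
Proof. by rewrite {1}[u]mpolyE bact_suml; apply: eq_bigr => m _; rewrite bactZX. Qed.

(** The elements of [S(h^* ) W S(h)]; that they exhaust [H] is the easy half of the PBW
    theorem. *)
Inductive pbw : H -> Prop :=
  | pbw_add z z' of pbw z & pbw z' : pbw (z + z')
  | pbw_mon f w q : pbw (XH f * wH w * YH q).

Lemma pbw_all z : pbw z.
Proof.
have pbw0 : pbw 0 by have := pbw_mon 0 1%g 0; rewrite XH0 !mul0r.
elim/cherednik_ind: z => [|z z'|a z|x z|y z|v z].
- by have := pbw_mon 1 1%g 1; rewrite XH1 YH1 wH1 !mulr1.
- exact: pbw_add.
- elim=> {z} [z z' _ IHz _ IHz'|f w q]; first by rewrite scalerDr; exact: pbw_add.
  by rewrite !hscaleAl -XHZ; exact: pbw_mon.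
- elim=> {z} [z z' _ IHz _ IHz'|f w q]; first by rewrite mulrDr; exact: pbw_add.
  by rewrite !mulrA -XH_lform -XHM; exact: pbw_mon.
- elim=> {z} [z z' _ IHz _ IHz'|f w q]; first by rewrite mulrDr; exact: pbw_add.
  rewrite !mulrA (yHXH hroots) 2!mulrBl 2!mulrDl -addrA; apply: pbw_add.
    have -> : yH y = yH (act w (act w^-1%g y)) by rewrite -actM mulgV act1.
    rewrite -(mulrA (XH f)) -wHyH -!mulrA -YH_lform -YHM mulrA.
    exact: pbw_mon.
  apply: pbw_add; first exact: pbw_mon.
  rewrite -mulNr -mulNr -sumrN !mulr_suml; elim/big_ind: _ => // [|s _].
    exact: pbw_add.
  by rewrite -scaleNr -!hscaleAl -(mulrA (XH _)) -wHM !hscaleAl -XHZ; exact: pbw_mon.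
elim=> {z} [z z' _ IHz _ IHz'|f w q]; first by rewrite mulrDr; exact: pbw_add.
by rewrite !mulrA wHXH -(mulrA (XH _)) -wHM; exact: pbw_mon.
Qed.

(** ** The order filtration of [He] *)

(** The map [f y^m |-> f y^m e] of [L] onto [He]. *)
Definition psi u : H := bact u 1 * eH.

(** Order less than [k], as for [msize]. *)
Definition filt k z := exists2 u, (msize u <= k)%N & z = psi u.

Lemma psiD u v : psi (u + v) = psi u + psi v.
Proof. by rewrite /psi bactDl mulrDl. Qed.
Lemma psi0 : psi 0 = 0.
Proof. by rewrite /psi bact0l mul0r. Qed.
Lemma psi_sum (I : Type) (r : seq I) (P : pred I) (F : I -> L) :
  psi (\sum_(i <- r | P i) F i) = \sum_(i <- r | P i) psi (F i).
Proof. exact: (big_morph psi psiD psi0). Qed.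
Lemma psiCM f u : psi (f%:MP * u) = XH f * psi u.
Proof. by rewrite /psi bactM bactC mulrA. Qed.
Lemma psi_lift q : psi (lift_y q) = YH q * eH.
Proof. by rewrite /psi bact_lift mul1r. Qed.
Lemma psiX m : psi 'X_[m] = YH 'X_[m] * eH.
Proof. by rewrite -psi_lift lift_yX. Qed.
Lemma psiXU i m : psi ('X_i * 'X_[m]) = yH (delta_mx i 0) * psi 'X_[m].
Proof. by rewrite -mpolyXD !psiX mpolyXD YHM YH_X mulrA. Qed.
Lemma psiE u : psi u = \sum_(m <- msupp u) XH u@_m * psi 'X_[m].
Proof.
by rewrite {1}[u]mpolyE psi_sum; apply: eq_bigr => m _; rewrite -mul_mpolyC psiCM.
Qed.

Lemma filt0 k : filt k 0.
Proof. by exists 0; rewrite ?msize0 ?psi0. Qed.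
Lemma filtD k z z' : filt k z -> filt k z' -> filt k (z + z').
Proof.
case=> [u uk ->] [v vk ->]; exists (u + v); last by rewrite psiD.
by apply: leq_trans (msizeD_le _ _) _; rewrite geq_max uk.
Qed.
Lemma filt_le k l z : (k <= l)%N -> filt k z -> filt l z.
Proof. by move=> kl [u uk ->]; exists u => //; exact: leq_trans kl. Qed.
Lemma filtXH k f z : filt k z -> filt k (XH f * z).
Proof.
case=> [u uk ->]; exists (f%:MP * u); last by rewrite psiCM.
by rewrite mul_mpolyC; exact: leq_trans (msizeZ_le _ _) uk.
Qed.
Lemma filtZ k (a : K) z : filt k z -> filt k (a *: z).
Proof. by move=> /(filtXH a%:MP); rewrite XHC -hscaleAl mul1r. Qed.
Lemma filtN k z : filt k z -> filt k (- z).
Proof. by rewrite -scaleN1r; exact: filtZ. Qed.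
Lemma filt_sum k (I : eqType) (r : seq I) (P : pred I) (F : I -> H) :
  (forall i, i \in r -> P i -> filt k (F i)) -> filt k (\sum_(i <- r | P i) F i).
Proof.
move=> rF; rewrite big_seq_cond; elim/big_ind: _ => [||i /andP[]].
- exact: filt0.
- exact: filtD.
exact: rF.
Qed.

Lemma filtYH q : filt (msize q) (YH q * eH).
Proof.
exists (lift_y q); last by rewrite psi_lift.
apply/msize_leP => m qm; rewrite mcoeff_lift_y.
by rewrite (proj1 (msize_leP _ _) (leqnn _)) ?mpolyC0.
Qed.

Lemma filt_wH k w z : filt k z -> filt k (wH w * z).
Proof.
case=> [u uk ->]; rewrite psiE mulr_sumr; apply: filt_sum => m mu _.
rewrite mulrA wHXH -mulrA; apply: filtXH; rewrite psiX mulrA wHYH -mulrA wHeH.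
apply: filt_le (filtYH _); apply: leq_trans (msize_lsubst _ _) _.
by rewrite msizeX; apply: leq_trans uk; exact: msize_mdeg_lt.
Qed.

(** Up to lower order [y] commutes with [S(h^* )], since its commutator with an element of
    [S(h^* )] has order zero. *)
Lemma yH_psi i u : filt (msize u) (yH (delta_mx i 0) * psi u - psi ('X_i * u)).
Proof.
rewrite [u in psi ('X_i * u)]mpolyE mulr_sumr psi_sum psiE mulr_sumr -sumrB.
apply: filt_sum => m mu _; rewrite mulrA (yHXH hroots) mulrBl mulrDl.
have filtm : filt (msize u) (psi 'X_[m]).
  by exists 'X_[m] => //; rewrite msizeX; exact: msize_mdeg_lt.
rewrite -mul_mpolyC mulrCA psiCM psiXU [X in _ + _ - X - _]mulr_suml.
rewrite addrAC [X in X - _ - _]addrC -mulrA addrK; apply: filtD; first exact: filtXH.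
apply: filtN; apply: filt_sum => s _ _; rewrite -hscaleAl -mulrA.
exact/filtZ/filtXH/filt_wH.
Qed.

Lemma filt_yH k i z : filt k z -> filt k.+1 (yH (delta_mx i 0) * z).
Proof.
case=> [u uk ->]; rewrite -[_ * _](subrK (psi ('X_i * u))); apply: filtD.
  by apply: filt_le (yH_psi i u); exact: leqW.
exists ('X_i * u) => //; case: k uk => [|k] uk.
  by move: uk; rewrite leqn0 msize_poly_eq0 => /eqP->; rewrite mulr0 msize0.
by apply: (@msizeM_leS _ _ _ _ 1 k) => //; rewrite msizeX mdeg1.
Qed.

Lemma heH_psi z : exists u, z * eH = psi u.
Proof.
elim: {z}(pbw_all z) => [z z' _ [u uE] _ [v vE]|f w q].
  by exists (u + v); rewrite mulrDl uE vE psiD.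
exists (f%:MP * lift_y (wsub w q)).
by rewrite psiCM psi_lift -!mulrA (mulrA (wH w)) wHYH -(mulrA _ (wH w)) wHeH.
Qed.

(** The Poisson bracket of [u] with a polynomial [p] of [S(h^* )]. *)
Definition poisson p : L -> L := locked_with bact_key
  (fun u => \sum_k (dirder (delta_mx k 0) p)%:MP * u^`M(k)).

Lemma poissonE p u : poisson p u = \sum_k (dirder (delta_mx k 0) p)%:MP * u^`M(k).
Proof. by rewrite /poisson unlock. Qed.

Lemma poissonD p : {morph poisson p : u v / u + v}.
Proof.
move=> u v; rewrite !poissonE -big_split; apply: eq_bigr => k _.
by rewrite mderivD mulrDr.
Qed.

Lemma poissonCM p f u : poisson p (f%:MP * u) = f%:MP * poisson p u.
Proof.
rewrite !poissonE mulr_sumr; apply: eq_bigr => k _.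
by rewrite mderiv_mulC mulrCA.
Qed.

Lemma poisson1 p : poisson p 1 = 0.
Proof. by rewrite poissonE big1 // => k _; rewrite -[1]mpolyC1 mderivC mulr0. Qed.

Lemma poissonXM p i u :
  poisson p ('X_i * u) = 'X_i * poisson p u + (dirder (delta_mx i 0) p)%:MP * u.
Proof.
rewrite !poissonE mulr_sumr addrC (bigD1 i) //= [in RHS](bigD1 i) //= addrA.
congr (_ + _).
  by rewrite mderivM mderivXU eqxx mpolyC1 mul1r mulrDr mulrCA.
apply: eq_bigr => k /negPf ki; rewrite mderivM mderivXU ki mpolyC0 mul0r add0r.
by rewrite mulrCA.
Qed.

Lemma mcoeff_poisson p u m :
  (poisson p u)@_m = \sum_k dirder (delta_mx k 0) p * (u@_(m + U_(k)) *+ (m k).+1).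
Proof.
rewrite poissonE raddf_sum; apply: eq_bigr => k _ /=.
by rewrite mcoeffCM mcoeff_mderiv.
Qed.

(** Since [[y, p]] is the derivative of [p] for an invariant [p], the commutator with [p]
    follows the Leibniz rule of the Poisson bracket, up to moving the [y] past [S(h^* )]. *)
Lemma psi_commX m p : invariant rho p ->
  filt (mdeg m).-1 (YH 'X_[m] * XH p * eH - XH p * psi 'X_[m] - psi (poisson p 'X_[m])).
Proof.
move=> pW; elim/mnm_ind: m => [|i m IHm].
  rewrite !mpolyX0 poisson1 psi0 subr0 YH1 mul1r.
  by rewrite /psi bact1 mul1r subrr; exact: filt0.
rewrite mdegD mdeg1 /=; move: IHm.
have vm : (msize (poisson p 'X_[m]) <= mdeg m)%N.
  apply/msize_leP => m' mm'; rewrite mcoeff_poisson big1 // => k _ /=.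
  rewrite mcoeffX; case: eqVneq => [E|]; last by rewrite mul0rn mulr0.
  by move: mm'; rewrite E mdegD mdeg1 addn1 ltnn.
rewrite !mpolyXD poissonXM psiXU psiD psiCM YHM YH_X.
have := yH_psi i (poisson p 'X_[m]).
move: (poisson p 'X_[m]) vm => v vm /(filt_le vm) filtv.
have -> : yH (delta_mx i 0) * YH 'X_[m] * XH p * eH = yH (delta_mx i 0) * (YH 'X_[m] * XH p * eH).
  by rewrite !mulrA.
move: (YH 'X_[m] * XH p * eH) => z.
have Exp : XH p * (yH (delta_mx i 0) * psi 'X_[m])
    = yH (delta_mx i 0) * (XH p * psi 'X_[m]) - XH (dirder (delta_mx i 0) p) * psi 'X_[m].
  by rewrite mulrA [RHS]addrC [in RHS]mulrA (yHXH_inv hroots) // mulrDl addrC addrK.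
rewrite Exp; move: (XH p * psi _) (XH (dirder _ _) * _) => a b filtz.
have -> : yH (delta_mx i 0) * z - (yH (delta_mx i 0) * a - b) - (psi ('X_i * v) + b)
   = yH (delta_mx i 0) * (z - a - psi v) + (yH (delta_mx i 0) * psi v - psi ('X_i * v)).
  rewrite !mulrBr addrA subrK opprB opprD addrACA [b - _]addrC addrK.
  by rewrite addrAC.
apply: filtD filtv; case: (posnP (mdeg m)) => [m0|m_gt0]; last first.
  by rewrite -[X in filt X](prednK m_gt0); exact: filt_yH.
move: filtz; rewrite m0 => -[u]; rewrite leqn0 msize_poly_eq0 => /eqP-> ->.
by rewrite psi0 mulr0; exact: filt0.
Qed.

Lemma psi_comm u p : invariant rho p ->
  filt (msize u).-2 (psi u * XH p - XH p * psi u - psi (poisson p u)).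
Proof.
move=> pW; have D0 : poisson p 0 = 0.
  by rewrite -[0 in LHS](mul0r 0) -mpolyC0 poissonCM mpolyC0 mul0r.
have -> : poisson p u = \sum_(m <- msupp u) (u@_m)%:MP * poisson p 'X_[m].
  rewrite {1}[u]mpolyE (big_morph (poisson p) (poissonD p) D0).
  by apply: eq_bigr => m _; rewrite -mul_mpolyC poissonCM.
rewrite psi_sum [psi u]psiE mulr_suml mulr_sumr -!sumrB.
apply: filt_sum => m mu _; rewrite psiCM [XH p * _]mulrA [XH p * XH _]XHXH -[XH _ * XH p * _]mulrA.
have -> : XH u@_m * psi 'X_[m] * XH p = XH u@_m * (YH 'X_[m] * XH p * eH).
  by rewrite psiX -(mulrA (XH _)) -(mulrA (YH _)) eHXH // (mulrA (YH _)).
rewrite -!mulrBr; apply: filtXH; apply: filt_le (psi_commX m pW).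
by have := msize_mdeg_lt mu; case: (msize u) => // -[|k]; case: (mdeg m).
Qed.

End BimoduleAction.

(** * Two-sided ideals *)

Section Ideals.
Variables (K : numFieldType) (n : nat) (W : finGroupType).
Variable rho : mx_representation K [set: W]%G n.
Variables (alpha : W -> 'rV[K]_n) (alphav : W -> 'cV[K]_n) (lambda : W -> K).
Hypothesis hroots : root_choice rho alpha alphav lambda.
Variable c : W -> K.
Local Notation refl := (reflections rho).
Local Notation wact := (wact rho).
Local Notation dual_act := (dual_act rho).
Local Notation H := (cherednik rho alpha alphav c).
Local Notation xH := (xH rho alpha alphav c).
Local Notation yH := (yH rho alpha alphav c).
Local Notation wH := (wH rho alpha alphav c).
Local Notation eH := (eH rho alpha alphav c).
Local Notation XH := (XH rho alpha alphav c).
Local Notation YH := (YH rho alpha alphav c).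
Local Notation bact := (@bact _ _ _ rho alpha alphav c).
Local Notation psi := (psi rho alpha alphav c).
Local Notation S := {mpoly K[n]}.
Local Notation L := {mpoly {mpoly K[n]}[n]}.
Implicit Types (w s : W) (x : 'rV[K]_n) (y : 'cV[K]_n) (f g p q : S) (u v : L) (z : H).

Section OneIdeal.
Variable I : set H.
Hypothesis idealI : two_sided_ideal I.

Let I0 : I 0. Proof. by case: idealI. Qed.
Let ID z z' : I z -> I z' -> I (z + z'). Proof. by case: idealI => _ + _ _; apply. Qed.
Let Il z z' : I z' -> I (z * z'). Proof. by case: idealI => _ _ + _; apply. Qed.
Let Ir z z' : I z -> I (z * z'). Proof. by case: idealI => _ _ _; apply. Qed.
Let IN z : I z -> I (- z). Proof. by move=> Iz; rewrite -mulN1r; exact: Il. Qed.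
Let Isum (J : Type) (r : seq J) (P : pred J) (F : J -> H) :
  (forall j, P j -> I (F j)) -> I (\sum_(j <- r | P j) F j).
Proof. by move=> IF; elim/big_ind: _. Qed.

Lemma ideal_bact u z : I z -> I (bact u z).
Proof. by move=> Iz; rewrite bactE; apply: Isum => m _; exact/Ir/Il. Qed.

(** By induction on the order. The commutators of [psi u] with the invariants [p] are in
    [I] and of lower order, so they come from the zero polynomial; hence [poisson p u] has
    no terms of degree one less than [u]. The corresponding coefficients are derivations in
    [p] with coefficients from the leading term of [u], and [derivation_inv_eq0] makes
    that leading term vanish unless its degree is zero. *)
Lemma ideal_psi_eq0 : (forall f, I (XH f * eH) -> f = 0) -> forall u, I (psi u) -> u = 0.
Proof.
move=> If u; have [N] := ubnP (msize u); elim: N u => // -[|N] IHN u.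
  by rewrite ltnS leqn0 msize_poly_eq0 => /eqP->.
rewrite ltnS => uN Iu; case: N => [|N] in IHN uN.
  move: Iu; rewrite (msize1_polyC uN) -[_%:MP]mulr1 psiCM.
  by rewrite /psi bact1 mul1r => /If->; rewrite mpolyC0 mul0r.
suff top m k : mdeg m = N -> u@_(m + U_(k)) = 0.
  apply: IHN => //; rewrite ltnS; apply/msize_leP => m.
  rewrite leq_eqVlt => /predU1P[Nm|]; last exact: (proj1 (msize_leP _ _) uN).
  have /mnm_succ[i [m' Em]] : m != 0%MM by apply: contra_eq_neq Nm => ->; rewrite mdeg0.
  rewrite Em addmC; apply: top; move: Nm.
  by rewrite Em mdegD mdeg1 => -[].
move=> Nm; pose a k : S := u@_(m + U_(k)) *+ (m k).+1.
have key p : invariant rho p -> \sum_k dirder (delta_mx k 0) p * a k = 0.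
  move=> pW; have [r rN E] := psi_comm hroots c u pW.
  have rN' : (msize r <= N)%N.
    by apply: leq_trans rN _; move: uN; case: (msize u) => // -[|k'].
  have Ipr : I (psi (poisson p u + r)).
    by rewrite psiD -E addrC subrK; apply: ID; [exact: Ir|exact/IN/Il].
  have := congr1 (mcoeff m) (IHN _ _ Ipr).
  rewrite mcoeffD mcoeff0 (proj1 (msize_leP r N)) ?addr0 ?Nm // mcoeff_poisson.
  apply; rewrite ltnS; apply/msize_leP => m' Nm'; rewrite mcoeffD.
  rewrite (proj1 (msize_leP r N)) ?addr0 ?(ltnW Nm') // mcoeff_poisson big1 // => j _.
  by rewrite (proj1 (msize_leP _ _) uN) ?mul0rn ?mulr0 // mdegD mdeg1 addn1.
pose d g : S := \sum_k dirder (delta_mx k 0) g * a k.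
have dX j : d 'X_j = a j.
  rewrite /d (bigD1 j) //= -lform_delta dirder_lform /pairing.
  rewrite mul_delta_mx mxE !eqxx mpolyC1 mul1r big1 ?addr0 // => l lj.
  by rewrite dirder_lform /pairing mul_delta_mx_0 1?eq_sym // mxE mpolyC0 mul0r.
have d0 g : d g = 0.
  apply: (@derivation_inv_eq0 _ _ _ rho d) => // [f1 f2|f1 f2].
    by rewrite /d -big_split; apply: eq_bigr => j _; rewrite raddfD mulrDl.
  rewrite /d mulr_suml mulr_sumr -big_split; apply: eq_bigr => j _.
  by rewrite dirderM mulrDl mulrAC mulrA.
have /eqP := dX k; rewrite d0 eq_sym /a -mulr_natr mulf_eq0.
by rewrite -mpolyC_nat mpolyC_eq0 pnatr_eq0 orbF => /eqP.
Qed.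

End OneIdeal.

Definition sepfactor (x : W -> 'rV[K]_n) (ws : seq W) w : S :=
  \prod_(v <- ws) (lform (dual_act w (x v)) - lform (dual_act v (x v))).

(** [HeH] meets [S(h^* )]: the operators [z |-> z x_v - (v x_v) z] for [v != 1], with [x_v]
    moved by [v], kill in turn the terms of [e] outside [S(h^* )]. *)
Lemma sep_ideal : mx_faithful rho ->
  exists2 F : S, F != 0 & forall I : set H, two_sided_ideal I ->
    forall f, I (XH f * eH) -> I (XH (f * F)).
Proof.
move=> faith.
have /choice[x xP] : forall w, exists z : 'rV[K]_n, w != 1%g -> dual_act w z != z.
  move=> w.
  have [->|w1] := eqVneq w 1%g; first by exists 0.
  by have [z zP] := exists_moved faith w1; exists z.
pose ws := [seq w <- enum W | w != 1%g].
exists (sepfactor x ws 1%g).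
  rewrite /sepfactor big_seq; elim/big_ind: _ => [||w]; first exact: oner_neq0.
    by move=> a b; exact: mulf_neq0.
  rewrite mem_filter => /andP[w1 _]; rewrite -lformB lform_eq0 dual_act1 subr_eq0.
  by rewrite eq_sym; exact: xP.
move=> I [I0 ID Il Ir] f If.
have IZ a z : I z -> I (a *: z).
  by move=> Iz; rewrite -[z]mul1r hscaleAl; exact: Il.
pose z vs : H := \sum_w XH (f * sepfactor x vs w) * wH w.
have Iz vs : I (z vs).
  elim: vs => [|v vs IHvs].
    rewrite /z (eq_bigr (fun w => XH f * wH w)); last first.
      by move=> w _; rewrite /sepfactor big_nil mulr1.
    have W0 : (#|W|%:R : K) != 0.
      by rewrite pnatr_eq0 -lt0n; apply/card_gt0P; exists 1%g.
    have := IZ #|W|%:R _ If; rewrite /eH -hscaleAr scalerA divff // scale1r.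
    by rewrite mulr_sumr.
  suff -> : z (v :: vs) = z vs * xH (x v) + (- xH (dual_act v (x v))) * z vs.
    by apply: ID; [exact: Ir|exact: Il].
  rewrite mulNr /z mulr_suml mulr_sumr -sumrB; apply: eq_bigr => w _.
  rewrite -mulrA wHxH mulrA -!XH_lform -[in RHS]XHM mulrA -XHM -mulrBl -XHB.
  congr (XH _ * _); rewrite /sepfactor big_cons.
  by rewrite mulrCA mulrBl [in X in X - _]mulrC.
suff -> : XH (f * sepfactor x ws 1%g) = z ws by exact: Iz.
rewrite /z (bigD1 1%g) //= wH1 mulr1 big1 ?addr0 // => w w1.
rewrite /sepfactor (big_rem w) /=; last by rewrite mem_filter w1 mem_enum.
by rewrite subrr mul0r mulr0 XH0 mul0r.
Qed.

(** ** [eH] as a module over invariants on the left and [S(h)] on the right *)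

Local Notation A := {ffun 'I_n -> 'I_#|W|}.
(** Generators of [eH]: an invariant coefficient of [bounded_mnm a] commutes with [e] and
    so may act on the left. *)
Definition eH_gen (a : A) : H := eH * XH (bounded_mnm K a).

Lemma eH_span z : exists u : A -> L, eH * z = \sum_a bact (u a) (eH_gen a).
Proof.
elim: {z}(pbw_all hroots z) => [z z' _ [u uE] _ [v vE]|f w q].
  exists (fun a => u a + v a); rewrite mulrDr uE vE -big_split.
  by apply: eq_bigr => a _; rewrite bactDl.
have [p pW fE] := integral_span rho (wact w^-1%g f).
exists (fun a => (p a)%:MP * lift_y (q)).
have -> : eH * (XH f * wH w * YH q) = eH * XH (wact w^-1%g f) * YH q.
  rewrite -[f in LHS](wactK rho w^-1%g) invgK -wHXH.
  by rewrite (mulrA eH) (mulrA eH) eHwH.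
rewrite fE XH_sum mulr_sumr mulr_suml; apply: eq_bigr => a _.
rewrite bactM bactC bact_lift /eH_gen XHM (mulrA eH) (eHXH _ _ _ (pW a)).
by rewrite -(mulrA (XH (p a)) eH) -(mulrA (XH (p a)) (eH * _)).
Qed.

(** Nakayama's lemma: the determinant trick is applied to the generators [eH_gen a] modulo
    [I], in [H], on which all of [L] acts and where it preserves [I]. *)
Lemma eH_nakayama (I : set H) : two_sided_ideal I ->
    (forall z, exists b : 'I_n -> H, I (eH * z - \sum_i eH * b i * yH (delta_mx i 0))) ->
  exists2 u : L, u@_0%MM = 1 & forall z, I (bact u (eH * z)).
Proof.
move=> idealI Ib; have [I0 ID Il Ir] := idealI.
have Isum (J : Type) (r : seq J) (P : pred J) (F : J -> H) :
    (forall j, P j -> I (F j)) -> I (\sum_(j <- r | P j) F j).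
  by move=> IF; elim/big_ind: _.
pose m (i : 'I_#|A|) := eH_gen (enum_val i).
have row i : exists B : 'I_#|A| -> L, (forall j, (B j)@_0%MM = (i == j)%:R)
    /\ I (\sum_j bact (B j) (m j)).
  have [b Ibi] := Ib (XH (bounded_mnm K (enum_val i))).
  have [u uE] := choice (fun k => eH_span (b k)).
  exists (fun j => (i == j)%:R - \sum_k 'X_k * u k (enum_val j)); split=> [j|].
    rewrite mcoeffB raddf_sum big1 ?subr0 => [|k _]; last first.
      by rewrite /= rmorphM /= mcoeffX mnm1_eq0 mul0r.
    by rewrite -mpolyC_nat mcoeffC eqxx mulr1.
  suff -> : \sum_j bact ((i == j)%:R - \sum_k 'X_k * u k (enum_val j)) (m j)
      = m i - \sum_k eH * b k * yH (delta_mx k 0) by [].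
  under eq_bigr => j _ do rewrite bactDl bactN bact_suml.
  rewrite big_split sumrN /= (bigD1 i) //= eqxx bact1 big1 ?addr0 => [|j /negPf ji]; last first.
    by rewrite eq_sym ji bact0l.
  congr (_ - _); rewrite exchange_big /=; apply: eq_bigr => k _.
  rewrite uE mulr_suml [RHS](reindex _ (onW_bij _ (enum_val_bij A))) /=.
  by apply: eq_bigr => j _; rewrite bactM bactX.
have [B] := choice row; move=> BP.
pose M := \matrix_(i, j) B i j : 'M[L]_#|A|.
have IM i : I (\sum_j bact (M i j) (m j)).
  by under eq_bigr => j _ do rewrite mxE; exact: (BP i).2.
exists (\det M).
  have -> : (\det M)@_0%MM = \det (map_mx (mcoeff 0%MM) M) by rewrite -det_map_mx.
  rewrite (_ : map_mx _ _ = 1%:M) ?det1 //.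
  by apply/matrixP => i j; rewrite !mxE (BP i).1.
have Idet i : I (bact (\det M) (m i)).
  have -> : bact (\det M) (m i) = \sum_k bact ((\adj M) i k) (\sum_j bact (M k j) (m j)).
    under eq_bigr => k _ do rewrite bact_sumr.
    rewrite exchange_big (bigD1 i) //= [X in _ + X]big1 ?addr0 => [|j ji].
      have /matrixP/(_ i i) := mul_adj_mx M; rewrite mxE [RHS]mxE eqxx mulr1n => <-.
      by rewrite bact_suml; apply: eq_bigr => k _; rewrite bactM.
    under eq_bigr => k _ do rewrite -bactM.
    rewrite -bact_suml; have /matrixP/(_ i j) := mul_adj_mx M; rewrite mxE [RHS]mxE.
    by move=> ->; rewrite eq_sym (negPf ji) mulr0n bact0l.
  by apply: Isum => k _; exact: ideal_bact.
move=> z; have [v ->] := eH_span z; rewrite bact_sumr; apply: Isum => a _.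
rewrite -bactM mulrC bactM; apply: ideal_bact => //.
by rewrite -[a]enum_rankK; exact: Idet.
Qed.

(** ** The Euler element *)

(** Normalised so that [[y, euler] = y]: the second sum cancels the group elements in the
    commutators of [y] with the first. *)
Definition euler : H := \sum_i xH (delta_mx 0 i) * yH (delta_mx i 0)
  - \sum_(s in refl) (c s / kap lambda s) *: wH s.

Lemma yH_euler y : yH y * euler = euler * yH y + yH y.
Proof.
rewrite /euler mulrBr mulrBl mulr_sumr mulr_suml.
have Ew s : s \in refl -> yH y * wH s
    = wH s * yH y - (kap lambda s * pairing y (alpha s)) *: (wH s * yH (alphav s)).
  move=> sR; rewrite -{1}[y](act1 rho) -(mulgV s) actM -wHyH (act_reflV hroots) //.
  rewrite -scaleNr addrC yH_lin mulrDr -hscaleAr scaleNr addrC //.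
have -> : yH y * (\sum_(s in refl) (c s / kap lambda s) *: wH s)
   = (\sum_(s in refl) (c s / kap lambda s) *: wH s) * yH y
     - \sum_(s in refl) (c s * pairing y (alpha s)) *: (wH s * yH (alphav s)).
  rewrite mulr_sumr mulr_suml -sumrB; apply: eq_bigr => s sR.
  rewrite -hscaleAr Ew // scalerBr scalerA [_ *: (wH s * yH y)]hscaleAl.
  congr (_ - _ *: _).
  by rewrite mulrA divfK // (kap_neq0 hroots).
have Ex i : yH y * (xH (delta_mx 0 i) * yH (delta_mx i 0))
    = xH (delta_mx 0 i) * yH (delta_mx i 0) * yH y + y i 0 *: yH (delta_mx i 0)
      - \sum_(s in refl) (c s * pairing y (alpha s) * (alphav s) i 0) *: (wH s * yH (delta_mx i 0)).
  have pe (y' : 'cV[K]_n) : pairing y' (delta_mx 0 i) = y' i 0.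
    by rewrite /pairing -rowE mxE.
  rewrite mulrA -[yH y * xH _](subrK (xH (delta_mx 0 i) * yH y)) yHxH addrC mulrDl.
  rewrite -mulrA yHC mulrA -addrA; congr (_ + _); rewrite mulrBl pe -hscaleAl mul1r.
  congr (_ - _); rewrite mulr_suml; apply: eq_bigr => s _.
  by rewrite -hscaleAl pe mulrAC.
have ysum (y' : 'cV[K]_n) : \sum_i y' i 0 *: yH (delta_mx i 0) = yH y'.
  rewrite -(YH_lform _ _ _ _ y') /lform YH_sum; apply: eq_bigr => i _.
  by rewrite mxE YHZ YH_X.
under eq_bigr => i _ do rewrite Ex.
rewrite sumrB big_split /= ysum -mulr_suml exchange_big /=.
under [X in _ - X - _]eq_bigr => s _.
  under eq_bigr => i _ do rewrite -scalerA hscaleAr.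
  rewrite -scaler_sumr -mulr_sumr ysum.
  over.
by rewrite opprB addrA subrK addrAC.
Qed.

(** The Euler operator of the grading of [L] by the degree in its variables. *)
Definition eulerE u : L := \sum_(m <- msupp u) (u@_m *+ mdeg m) *: 'X_[m].

Lemma mcoeff_eulerE u m : (eulerE u)@_m = u@_m *+ mdeg m.
Proof.
rewrite /eulerE raddf_sum /=; have [mu|mu] := boolP (m \in msupp u).
  rewrite (bigD1_seq m) ?msupp_uniq //= mcoeffZ mcoeffX eqxx mulr1 big1 ?addr0 // => k km.
  by rewrite mcoeffZ mcoeffX (negPf km) mulr0.
rewrite (memN_msupp_eq0 mu) mul0rn big_seq big1 // => k ku.
rewrite mcoeffZ mcoeffX; case: eqVneq => [km|_]; last by rewrite mulr0.
by move: mu; rewrite -km ku.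
Qed.

Lemma bact_euler u z : bact u z * euler = bact u (z * euler) + bact (eulerE u) z.
Proof.
have Ym m : YH 'X_[m] * euler = euler * YH 'X_[m] + YH 'X_[m] *+ mdeg m.
  elim/mnm_ind: m => [|i m IHm].
    by rewrite mpolyX0 YH1 mulr1 mul1r mdeg0 mulr0n addr0.
  rewrite mpolyXD mdegD mdeg1 YHM -mulrA IHm mulrDr mulrA YH_X yH_euler mulrDl.
  by rewrite -mulrA -addrA mulrnAr mulrS.
have XHMn f k : XH (f *+ k) = XH f *+ k.
  by elim: k => [|k IHk]; rewrite ?mulr0n ?XH0 // !mulrS XHD IHk.
have -> : bact (eulerE u) z = \sum_(m <- msupp u) (XH u@_m * z * YH 'X_[m]) *+ mdeg m.
  rewrite /eulerE bact_suml; apply: eq_bigr => m _.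
  by rewrite bactZX XHMn !mulrnAl.
rewrite (bactE u z) (bactE u (z * euler)) mulr_suml -big_split; apply: eq_bigr => m _.
by rewrite -mulrA Ym mulrDr !mulrA mulrnAr.
Qed.

(** An ideal [I] for which [1 + (terms of positive degree in S(h))] annihilates [eH]
    modulo [I] contains [e]: right multiplication by the Euler element makes the
    annihilator stable under the grading of [S(h)], so that it contains [1]. *)
Lemma ideal_eH (I : set H) u : two_sided_ideal I -> u@_0%MM = 1 ->
  (forall z, I (bact u (eH * z))) -> I eH.
Proof.
move=> idealI u0 Iu; have [I0 ID Il Ir] := idealI.
have IN z : I z -> I (- z) by move=> Iz; rewrite -mulN1r; exact: Il.
pose Ann v := forall z, I (bact v (eH * z)).
have AnnM v v' : Ann v' -> Ann (v * v').
  by move=> Av z; rewrite bactM; apply: ideal_bact.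
have AnnD v v' : Ann v -> Ann v' -> Ann (v + v').
  by move=> Av Av' z; rewrite bactDl; exact: ID.
have AnnE v : Ann v -> Ann (eulerE v).
  move=> Av z; have -> : bact (eulerE v) (eH * z)
      = bact v (eH * z) * euler - bact v (eH * (z * euler)).
    by rewrite bact_euler (mulrA eH) addrC addKr.
  by apply: ID; [exact: Ir|exact/IN].
have strip N : forall v, (msize v <= N.+1)%N -> Ann v -> Ann (v@_0)%:MP.
  elim: N => [|N IHN] v vN Av; first by rewrite -(msize1_polyC vN).
  pose v' := eulerE v - N.+1%:R * v.
  have Ev' m : v'@_m = v@_m *+ mdeg m - v@_m *+ N.+1.
    by rewrite /v' mcoeffB mcoeff_eulerE -mpolyC_nat mcoeffCM mulr_natl.
  have /IHN : (msize v' <= N.+1)%N.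
    apply/msize_leP => m; rewrite Ev' leq_eqVlt => /predU1P[<-|mN]; first by rewrite subrr.
    by rewrite (proj1 (msize_leP _ _) vN) ?mul0rn ?subrr.
  have Av' : Ann v'.
    by apply: AnnD; [exact: AnnE|rewrite -mulNr; exact: AnnM].
  move=> /(_ Av') /(AnnM (((- N.+1%:R : K)^-1)%:MP%:MP)).
  rewrite Ev' mdeg0 mulr0n add0r -mpolyCM mul_mpolyC -scaler_nat -scaleNr scalerA.
  by rewrite mulVf ?scale1r // oppr_eq0 pnatr_eq0.
have := strip (msize u) u (leqnSn _) Iu 1.
by rewrite u0 mpolyC1 bact1 mulr1.
Qed.

End Ideals.

(** * Quotients by left ideals *)

Record left_ideal (A : pzRingType) := LeftIdeal {
  li_mem :> A -> Prop;
  li_0 : li_mem 0;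
  li_add : forall a b, li_mem a -> li_mem b -> li_mem (a + b);
  li_mul : forall a b, li_mem b -> li_mem (a * b) }.

Section LeftQuotient.
Variables (A : pzRingType) (J : left_ideal A).

Definition li_pred : pred A := fun a => `[< J a >].

Fact li_pred_zmod : zmod_closed li_pred.
Proof.
split=> [|u v]; rewrite !unfold_in; first by apply/asboolP; exact: li_0.
move=> /asboolP Ju /asboolP Jv; apply/asboolP; apply: li_add => //.
by rewrite -mulN1r; exact: li_mul.
Qed.
HB.instance Definition _ := GRing.isZmodClosed.Build A li_pred li_pred_zmod.
Definition li_closed : zmodClosed A := GRing.ZmodClosed.clone A li_pred _.

Definition lquot : Type := Quotient.quot li_closed.
HB.instance Definition _ := GRing.Zmodule.on lquot.

Definition lclass (a : A) : lquot := (\pi_(Quotient.quot li_closed) a)%qT.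
Definition lrep (m : lquot) : A := repr (m : Quotient.quot li_closed).

Lemma lrepK m : lclass (lrep m) = m.
Proof. exact: reprK. Qed.

Lemma lclassD : {morph lclass : a b / a + b}.
Proof. exact: (raddfD \pi_(Quotient.quot li_closed)%qT). Qed.

Lemma lclass_eq a b : lclass a = lclass b <-> J (a - b).
Proof.
have -> : J (a - b) <-> a - b \in li_closed by rewrite unfold_in; split=> /asboolP.
by rewrite Quotient.idealrBE; split=> [E|/eqP//]; apply/eqP.
Qed.

Definition lscale (a : A) (m : lquot) : lquot := lclass (a * lrep m).

Lemma lscale_class a b : lscale a (lclass b) = lclass (a * b).
Proof.
apply/lclass_eq; rewrite -mulrBr; apply: li_mul; apply/lclass_eq.
exact: lrepK.
Qed.

Fact lscaleA a b m : lscale a (lscale b m) = lscale (a * b) m.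
Proof. by rewrite -[m]lrepK !lscale_class mulrA. Qed.
Fact lscale1 : left_id 1 lscale.
Proof. by move=> m; rewrite -[m]lrepK lscale_class mul1r. Qed.
Fact lscaleDr : right_distributive lscale +%R.
Proof.
by move=> a m m'; rewrite -[m]lrepK -[m']lrepK -lclassD !lscale_class mulrDr lclassD.
Qed.
Fact lscaleDl m : {morph lscale^~ m : a b / a + b}.
Proof. by move=> a b; rewrite -[m]lrepK !lscale_class mulrDl lclassD. Qed.

HB.instance Definition _ :=
  GRing.Zmodule_isLmodule.Build A lquot lscaleA lscale1 lscaleDr lscaleDl.

Lemma lclassZ a b : a *: lclass b = lclass (a * b).
Proof. exact: lscale_class. Qed.

Lemma lclass_eq0 a : lclass a = 0 <-> J a.
Proof.
have -> : (0 : lquot) = lclass 0.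
  by apply: (@addrI _ (lclass 0)); rewrite -lclassD !addr0.
by rewrite lclass_eq subr0.
Qed.

End LeftQuotient.

(** * Modules in category O *)

Section CategoryO.
Variables (K : numFieldType) (n : nat) (W : finGroupType).
Variable rho : mx_representation K [set: W]%G n.
Variables (alpha : W -> 'rV[K]_n) (alphav : W -> 'cV[K]_n) (lambda : W -> K).
Hypothesis hroots : root_choice rho alpha alphav lambda.
Variable c : W -> K.
Local Notation act := (Defs.act rho).
Local Notation H := (cherednik rho alpha alphav c).
Local Notation xH := (xH rho alpha alphav c).
Local Notation yH := (yH rho alpha alphav c).
Local Notation wH := (wH rho alpha alphav c).
Local Notation XH := (XH rho alpha alphav c).
Local Notation YH := (YH rho alpha alphav c).
Local Notation S := {mpoly K[n]}.
Implicit Types (w s : W) (x : 'rV[K]_n) (y : 'cV[K]_n) (f g p q : S) (z : H).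

Section Nilpotency.
Variable M : lmodType H.
Implicit Types m : M.

(** Unlike the nilpotency of a single [y], that of all products of [k] elements of [h] is
    stable under [W] and is propagated by [hnilp_xH]. *)
Fixpoint hnilp (k : nat) (m : M) : Prop :=
  if k is k'.+1 then forall y, hnilp k' (yH y *: m) else m = 0.

Lemma hnilp0 k : hnilp k 0.
Proof. by elim: k => //= k IHk y; rewrite scaler0. Qed.

Lemma hnilpD k m m' : hnilp k m -> hnilp k m' -> hnilp k (m + m').
Proof.
elim: k m m' => [|k IHk] m m' /=; first by move=> -> ->; rewrite addr0.
by move=> Nm Nm' y; rewrite scalerDr; exact: IHk.
Qed.

Lemma hnilpZ k (a : K) m : hnilp k m -> hnilp k ((a *: (1 : H)) *: m).
Proof.
elim: k m => [|k IHk] m /=; first by move=> ->; rewrite scaler0.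
move=> Nm y; rewrite scalerA -hscaleAr mulr1 -[yH y]mul1r hscaleAl -scalerA.
exact: IHk.
Qed.

Lemma hnilpS k m : hnilp k m -> hnilp k.+1 m.
Proof.
elim: k m => [|k IHk] m; first by move=> /= -> y; rewrite scaler0.
by move=> Nm y; exact: IHk.
Qed.

Lemma hnilp_le k l m : (k <= l)%N -> hnilp k m -> hnilp l m.
Proof. by move=> /subnK <-; elim: (l - k)%N => //= j IHj /IHj; exact: hnilpS. Qed.

Lemma hnilp_wH k w m : hnilp k m -> hnilp k (wH w *: m).
Proof.
elim: k m => [|k IHk] m /=; first by move=> ->; rewrite scaler0.
move=> Nm y; have -> : y = act w (act w^-1%g y) by rewrite -actM mulgV act1.
by rewrite scalerA -wHyH -scalerA; exact: IHk.
Qed.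

(** In [y x m = x (y m) + [y, x] m], the vector [y m] needs one factor less, and [[y, x]]
    is a combination of elements of [W]. *)
Lemma hnilp_xH k x m : hnilp k m -> hnilp k.+1 (xH x *: m).
Proof.
elim: k m => [|k IHk] m; first by move=> /= -> y; rewrite !scaler0.
move=> Nm y; rewrite scalerA -[yH y * xH x](subrK (xH x * yH y)) yHxH.
rewrite scalerDl -scalerA; apply: (@hnilpD k.+1); last exact: IHk.
rewrite scalerBl; apply: (@hnilpD k.+1); first exact: (@hnilpZ k.+1).
rewrite -scaleNr -sumrN scaler_suml; elim/big_ind: _ => [||s _].
- exact: (hnilp0 k.+1).
- exact: (@hnilpD k.+1).
rewrite -scaleNr -[wH s]mul1r hscaleAl -scalerA.
exact: (@hnilpZ k.+1 _ _ (@hnilp_wH k.+1 _ _ Nm)).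
Qed.

Lemma hnilp_all k m z : hnilp k m -> exists l, hnilp l (z *: m).
Proof.
move=> Nm; elim/cherednik_ind: z
  => [|z z' [l Nz] [l' Nz']|a z [l Nz]|x z [l Nz]|y z [l Nz]|w z [l Nz]].
- by exists k; rewrite scale1r.
- exists (maxn l l'); rewrite scalerDl; apply: hnilpD.
    by apply: hnilp_le Nz; exact: leq_maxl.
  by apply: hnilp_le Nz'; exact: leq_maxr.
- by exists l; rewrite -[z]mul1r hscaleAl -scalerA; exact: hnilpZ.
- by exists l.+1; rewrite -scalerA; exact: hnilp_xH.
- by exists l; rewrite -scalerA; exact: (hnilpS Nz).
by exists l; rewrite -scalerA; exact: hnilp_wH.
Qed.

Lemma hnilp_exp k y m : hnilp k m -> yH y ^+ k *: m = 0.
Proof.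
elim: k m => [|k IHk] m /=; first by move=> ->; rewrite scaler0.
by move=> Nm; rewrite exprSr -scalerA; exact: IHk.
Qed.

End Nilpotency.

(** ** The quotient of [H] by [I + Hh] *)

Variable I : set H.
Hypothesis idealI : two_sided_ideal I.

Definition verma_mem z := exists i, exists b : 'I_n -> H,
  I i /\ z = i + \sum_k b k * yH (delta_mx k 0).

Fact verma_mem0 : verma_mem 0.
Proof.
exists 0; exists (fun=> 0); split; first by case: idealI.
by rewrite big1 ?addr0 // => k _; rewrite mul0r.
Qed.

Fact verma_memD z z' : verma_mem z -> verma_mem z' -> verma_mem (z + z').
Proof.
have [_ ID _ _] := idealI; case=> [i [b [Ii ->]]] [i' [b' [Ii' ->]]].
exists (i + i'); exists (fun k => b k + b' k); split; first exact: ID.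
rewrite addrACA -big_split; congr (_ + _); apply: eq_bigr => k _.
by rewrite mulrDl.
Qed.

Fact verma_memM z z' : verma_mem z' -> verma_mem (z * z').
Proof.
have [_ _ Il _] := idealI; case=> [i [b [Ii ->]]].
exists (z * i); exists (fun k => z * b k); split; first exact: Il.
by rewrite mulrDr mulr_sumr; congr (_ + _); apply: eq_bigr => k _; rewrite mulrA.
Qed.

Definition verma_ideal := LeftIdeal verma_mem0 verma_memD verma_memM.
Definition verma := lquot verma_ideal.
HB.instance Definition _ := GRing.Lmodule.on verma.

Lemma verma_mem_y z y : verma_mem (z * yH y).
Proof.
exists 0; exists (fun k => z * (y k 0 *: (1 : H))); split; first by case: idealI.
rewrite add0r -{1}(YH_lform _ _ _ _ y) /lform YH_sum mulr_sumr; apply: eq_bigr => k _.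
by rewrite mxE YHZ YH_X -mulrA -hscaleAl mul1r.
Qed.

Lemma verma_mem_YH z q : verma_mem (z * YH q - q@_0%MM *: z).
Proof.
elim/lform_ind: q => [a|p q IHp IHq|x q IHq].
- rewrite YHC mcoeffC eqxx mulr1 -hscaleAr mulr1 subrr; exact: verma_mem0.
- rewrite YHD mulrDr mcoeffD scalerDl opprD addrACA; exact: verma_memD.
have -> : (lform x * q)@_0%MM = 0.
  rewrite rmorphM /= /lform raddf_sum big1 ?mul0r // => i _.
  by rewrite /= mcoeffZ mcoeffX mnm1_eq0 mulr0.
rewrite scale0r subr0.
by rewrite YHM YHYH mulrA -[x]trmxK YH_lform; exact: verma_mem_y.
Qed.

(** Only the constant terms of [S(h)] survive, so the image of [W] generates the quotient
    over [S(h^* )]. *)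
Lemma verma_span z : exists f : W -> S, verma_mem (z - \sum_w XH (f w) * wH w).
Proof.
elim: {z}(pbw_all hroots z) => [z z' _ [f fE] _ [g gE]|f w q].
  exists (fun w => f w + g w).
  under eq_bigr => w _ do rewrite XHD mulrDl.
  by rewrite big_split opprD addrACA; exact: verma_memD.
exists (fun v => if v == w then q@_0%MM *: f else 0).
rewrite (bigD1 w) //= eqxx big1 ?addr0 => [|v /negPf->]; last by rewrite XH0 mul0r.
by rewrite XHZ -hscaleAl; exact: verma_mem_YH.
Qed.

Lemma verma_category_O : category_O (verma : lmodType H).
Proof.
split.
  exists #|W|; exists (fun i => lclass verma_ideal (wH (enum_val i))) => m.
  rewrite -[m]lrepK; have [f fE] := verma_span (lrep m).
  exists (fun i => XH (f (enum_val i))); first by move=> i; apply/SdualP; eexists.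
  have -> : lclass verma_ideal (lrep m) = lclass verma_ideal (\sum_w XH (f w) * wH w).
    exact/lclass_eq.
  rewrite (reindex _ (onW_bij _ (enum_val_bij W))) /=.
  rewrite (big_morph _ (@lclassD _ verma_ideal) (id1 := 0)) //.
    by apply: eq_bigr => i _; rewrite lclassZ.
  by apply/lclass_eq0; exact: verma_mem0.
move=> y m; rewrite -[m]lrepK -[lrep m]mulr1 -lclassZ.
have [|l Nl] := @hnilp_all (verma : lmodType H) 1 (lclass verma_ideal 1) (lrep m).
  move=> y' /=; rewrite lclassZ mulr1; apply/lclass_eq0.
  by rewrite -[yH _]mul1r; exact: verma_mem_y.
by exists l; exact: hnilp_exp.
Qed.

End CategoryO.

(** * Total asphericity and simplicity of the spherical subalgebra *)

Section Equivalence.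
Variables (K : numFieldType) (n : nat) (W : finGroupType).
Variable rho : mx_representation K [set: W]%G n.
Hypothesis faithful_rho : mx_faithful rho.
Variables (alpha : W -> 'rV[K]_n) (alphav : W -> 'cV[K]_n) (lambda : W -> K).
Hypothesis hroots : root_choice rho alpha alphav lambda.
Variable c : W -> K.
Hypothesis hc : conj_invariant rho c.
Local Notation wact := (wact rho).
Local Notation H := (cherednik rho alpha alphav c).
Local Notation eHe := (spherical rho alpha alphav c).
Local Notation yH := (yH rho alpha alphav c).
Local Notation eH := (eH rho alpha alphav c).
Local Notation XH := (XH rho alpha alphav c).
Local Notation S := {mpoly K[n]}.

Lemma in_cornerP (z : H) : in_corner eH z <-> exists b, z = eH * b * eH.
Proof. by split=> [/asboolP|?]; last exact/asboolP. Qed.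

Lemma corner_ex (z : H) : exists u : eHe, val u = eH * z * eH.
Proof.
have zc : in_corner eH (eH * z * eH) by apply/in_cornerP; exists z.
by exists (Sub (eH * z * eH) zc : corner (eH_idem rho alpha alphav c)).
Qed.

Lemma annihilator_ideal (M : lmodType H) :
  two_sided_ideal [set z : H | forall m : M, z *: m = 0]%classic.
Proof.
split=> [m|a b az bz m|a b bz m|a b az m] /=.
- by rewrite scale0r.
- by rewrite scalerDl az bz addr0.
- by rewrite -scalerA bz scaler0.
by rewrite -scalerA az.
Qed.

(** Apply [sep_ideal] to the annihilator of [M]. *)
Lemma eH_killed_torsion (M : lmodType H) :
  (forall m : M, eH *: m = 0) -> torsion_Sdual M.
Proof.
have [F F0 FI] := sep_ideal alpha alphav c faithful_rho => eM m.
exists (XH F); split; first by apply/SdualP; exists F.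
  by apply: contra_neq F0 => /(XH_eq0 hroots hc).
have := FI _ (annihilator_ideal M) 1; rewrite mul1r; apply => m' /=.
by rewrite XH1 mul1r.
Qed.

(** A product of annihilators of the generators works, [S(h^* )] being a commutative
    domain. *)
Lemma torsion_XH_killed (M : lmodType H) : fin_gen_Sdual M -> torsion_Sdual M ->
  exists2 f : S, f != 0 & forall m : M, XH f *: m = 0.
Proof.
move=> [k [g gen]] tors.
have /choice[f fP] : forall i, exists f : S, f != 0 /\ XH f *: g i = 0.
  move=> i; have [a [/SdualP[f ->] f0 fg]] := tors (g i); exists f; split=> //.
  by apply: contra_neq f0 => ->; rewrite XH0.
exists (\prod_i f i); first by apply/prodf_neq0 => i _; exact: (fP i).1.
move=> m; have [a aS ->] := gen m; rewrite scaler_sumr big1 // => i _.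
have /SdualP[b ->] := aS i; rewrite scalerA XHXH (bigD1 i) //= mulrC XHM mulrA -scalerA.
by rewrite (fP i).2 scaler0.
Qed.

Lemma simple_torsion_killed (M : lmodType H) : simple_ring eHe ->
  fin_gen_Sdual M -> torsion_Sdual M -> forall m : M, eH *: m = 0.
Proof.
move=> simple fg tors; have [f f0 fM] := torsion_XH_killed fg tors.
pose p := \prod_(w : W) wact w f.
have pW : invariant rho p.
  move=> v; rewrite /p rmorph_prod [RHS](reindex_inj (mulgI v)) /=.
  by apply: eq_bigr => w _; rewrite -wactM.
have p0 : p != 0.
  apply/prodf_neq0 => w _; apply: contra_neq f0 => wf.
  by rewrite -[f](wactK rho w) wf raddf0.
have pM (m : M) : XH p *: m = 0.
  by rewrite /p (bigD1 1%g) //= wact1 mulrC XHM -scalerA fM scaler0.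
pose J : set eHe := [set u | forall m : M, val u *: m = 0]%classic.
have idealJ : two_sided_ideal J.
  split=> [m|a b az bz m|a b bz m|a b az m] /=.
  - by rewrite scale0r.
  - by rewrite scalerDl az bz addr0.
  - by rewrite -scalerA bz scaler0.
  by rewrite -scalerA az.
have [u uE] := corner_ex (XH p).
have Epe : eH * XH p * eH = XH p * eH by rewrite eHXH // -(mulrA (XH p)) eH_idem.
have Ju : J u by move=> m; rewrite uE Epe -eHXH // -scalerA pM scaler0.
case: (simple J idealJ) => [J0|JT m]; last first.
  have : J (1 : eHe) by rewrite JT.
  exact.
move: Ju; rewrite J0 => u0; move: uE; rewrite u0 Epe => /esym/(XHeH_eq0 hroots hc).
by move/eqP; rewrite (negPf p0).
Qed.

(** The largest ideal [I] of [H] with [eIe] contained in [J]. *)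
Definition ideal_above (J : set eHe) : set H :=
  [set z | forall b b', exists2 u, J u & val u = eH * b * z * b' * eH]%classic.

Lemma ideal_above_ideal (J : set eHe) :
  two_sided_ideal J -> two_sided_ideal (ideal_above J).
Proof.
move=> [J0 JD Jl Jr]; split=> [b b'|z z' Iz Iz' b b'|z z' Iz b b'|z z' Iz b b'].
- by exists 0; rewrite // mulr0 !mul0r.
- have [u Ju uE] := Iz b b'; have [u' Ju' uE'] := Iz' b b'.
  by exists (u + u'); [exact: JD|rewrite mulrDr !mulrDl -uE -uE'].
- have [u Ju uE] := Iz (b * z) b'; exists u => //.
  by rewrite uE (mulrA eH b z) (mulrA (eH * b) z z').
have [u Ju uE] := Iz b (z' * b'); exists u => //.
by rewrite uE (mulrA (eH * b * z)) (mulrA (eH * b) z).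
Qed.

Lemma ideal_above_val (J : set eHe) u : two_sided_ideal J -> J u -> ideal_above J (val u).
Proof.
move=> [J0 JD Jl Jr] Ju b b'; have [v vE] := corner_ex b; have [v' vE'] := corner_ex b'.
have [z zE] := (in_cornerP (val u)).1 (valP u).
have eu : eH * val u = val u by rewrite zE (mulrA eH (eH * z)) (mulrA eH eH) eH_idem.
have ue : val u * eH = val u by rewrite zE -(mulrA (eH * z)) eH_idem.
exists (v * u * v'); first exact/Jr/Jl.
rewrite -[val (v * u * v')]/(val v * val u * val v') vE vE'.
rewrite -(mulrA (eH * b) eH (val u)) eu (mulrA (eH * b * val u) (eH * b') eH).
by rewrite (mulrA (eH * b * val u) eH b') -(mulrA (eH * b) (val u) eH) ue.
Qed.

Lemma ideal_above_eH (J : set eHe) :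
  two_sided_ideal J -> ideal_above J eH -> J = setT.
Proof.
move=> [J0 JD Jl Jr] /(_ 1 1)[u Ju uE]; have u1 : u = 1.
  by apply: val_inj; rewrite uE !mulr1 !eH_idem.
by apply/seteqP; split=> // v _; rewrite -[v]mulr1; apply: Jl; rewrite -u1.
Qed.

Lemma aspherical_simple : totally_aspherical rho alpha alphav c -> simple_ring eHe.
Proof.
move=> asph J idealJ; pose I := ideal_above J.
have idealI : two_sided_ideal I by exact: ideal_above_ideal.
have [If|] := pselect (forall f : S, I (XH f * eH) -> f = 0).
  left; apply/seteqP; split=> [u Ju|_ ->]; last by case: idealJ.
  apply: val_inj => /=; have [z zE] := (in_cornerP (val u)).1 (valP u).
  have [v vE] := heH_psi hroots (eH * z); rewrite -zE in vE.
  have v0 : v = 0.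
    apply: (ideal_psi_eq0 hroots idealI If); rewrite -vE.
    exact: ideal_above_val.
  by rewrite vE v0 psi0.
move=> /existsNP[f /not_implyP[If /eqP f0]]; right; apply: ideal_above_eH => //.
have [I0 ID Il Ir] := idealI.
have [F F0 FI] := sep_ideal alpha alphav c faithful_rho.
have Ig : I (XH (f * F)) := FI I idealI f If.
pose M : lmodType H := verma idealI.
have torsM : torsion_Sdual M.
  move=> m; exists (XH (f * F)); split; first by apply/SdualP; eexists.
    have : f * F != 0 by rewrite mulf_neq0.
    by apply: contra_neq => /(XH_eq0 hroots hc).
  rewrite -[m]lrepK lclassZ; apply/lclass_eq0.
  exists (XH (f * F) * lrep m); exists (fun=> 0); split; first exact: Ir.
  by rewrite big1 ?addr0 // => k _; rewrite mul0r.
have eM := (asph M (verma_category_O hroots idealI)).1 torsM.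
have nak z : exists b : 'I_n -> H, I (eH * z - \sum_i eH * b i * yH (delta_mx i 0)).
  have := eM (lclass _ z); rewrite lclassZ => /lclass_eq0[i [b [Ii E]]].
  exists b; have -> : eH * z - \sum_k eH * b k * yH (delta_mx k 0) = eH * i.
    have {1}-> : eH * z = eH * (eH * z) by rewrite (mulrA eH eH) eH_idem.
    rewrite E mulrDr mulr_sumr -addrA -sumrB big1 ?addr0 // => k _.
    by rewrite mulrA subrr.
  exact: Il.
have [u u0 uP] := eH_nakayama hroots idealI nak.
exact: (ideal_eH hroots idealI u0 uP).
Qed.

Lemma aspherical_simpleP :
  totally_aspherical rho alpha alphav c <-> simple_ring eHe.
Proof.
split; first exact: aspherical_simple.
move=> simple M [fg _]; split; first exact: simple_torsion_killed.
exact: eH_killed_torsion.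
Qed.

End Equivalence.

Theorem proposition2p6 (R : realType) (n : nat) (W : finGroupType)
    (rho : mx_representation R[i] [set: W]%G n)
    (hW : is_complex_reflection_group rho)
    (alpha : W -> 'rV[R[i]]_n) (alphav : W -> 'cV[R[i]]_n) (lambda : W -> R[i])
    (hroots : root_choice rho alpha alphav lambda)
    (c : W -> R[i]) (hc : conj_invariant rho c) :
  totally_aspherical rho alpha alphav c <->
  simple_ring (spherical rho alpha alphav c).
Proof. case: hW => faith _. exact (aspherical_simpleP faith hroots hc). Qed.
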